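(* Let $F$ be a field, let $A$ be a finitely generated free abelian group, and let $F * A$ be a twisted group algebra of $A$ over $F$ such that $\dim(F * A) = \operatorname{rk}(A) - 1$. Let $Z$ be the unique subgroup of $A$ such that the center of $F * A$ is $\mathcal{Z}(F * A) = F * Z$. Then there exists a simple $F * A$-module $M$ with $$\operatorname{GKdim}(M) \ge \operatorname{rk}(A) - \operatorname{rk}(Z) - 1.$$
   Context: A twisted group algebra $F * A$ of a finitely generated free abelian group $A$ over a field $F$ is an associative unital $F$-algebra with an $F$-basis $\overline{A} = \{\bar a : a \in A\}$ that is a copy of $A$, with multiplication satisfying $\bar a_1 \bar a_2 = \tau(a_1,a_2)\,\overline{a_1a_2}$ for all $a_1,a_2 \in A$, where $\tau : A \times A \to F^* = F\setminus\{0\}$ satisfies $\tau(a_1,a_2)\tau(a_1a_2,a_3) = \tau(a_2,a_3)\tau(a_1,a_2a_3)$. (These algebras are the quantum tori: the $F$-algebras generated by $x_1,\dots,x_n$ and their inverses subject to $x_ix_j = q_{ij}x_jx_i$, with $n = \operatorname{rk}(A)$.) For a subgroup $B \le A$, $F * B$ denotes the subalgebra consisting of the elements $\sum_a \lambda_a \bar a$ of $F * A$ with $\lambda_a = 0$ for $a \notin B$. The center of $F*A$ is always of the form $F * Z$ for a unique subgroup $Z \le A$. $\operatorname{rk}$ denotes the (torsion-free) rank of an abelian group. $\dim(F * A)$ denotes either the Krull dimension or the global dimension of $F * A$; by a theorem of Brookes these both equal the supremum of the ranks of subgroups $B \le A$ such that $F * B$ is commutative. Modules are right modules. $\operatorname{GKdim}(M)$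 is the Gelfand–Kirillov dimension of $M$ as an $F * A$-module; for finitely generated $M$ it equals the supremum of the ranks of the subgroups $B \le A$ such that $M$ is not $F * B$-torsion, where $M$ is $F*B$-torsion if every $m \in M$ satisfies $mx = 0$ for some nonzero $x \in F * B$. *)

(* Defs.v *)
From HB Require Import structures.
From mathcomp Require Import all_boot all_order all_algebra.
From mathcomp Require Import all_classical all_reals all_analysis.

Set Implicit Arguments.
Unset Strict Implicit.
Unset Printing Implicit Defensive.

Import Order.TTheory GRing.Theory Num.Theory.
Import numFieldNormedType.Exports.

Local Open Scope classical_set_scope.
Local Open Scope ring_scope.

(* Abelian groups are written additively: the product of a and b in A is      *)
(* a + b, and the a-th power by k : int is a *~ k.                            *)
Section AbelianGroups.
Variable A : zmodType.

Definition fg_free_abelian : Prop :=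
  exists (n : nat) (e : 'I_n -> A),
    forall a : A, exists! c : 'rV[int]_n, a = \sum_i e i *~ c 0 i.

Definition is_subgroup (B : set A) : Prop :=
  B 0 /\ forall a b, B a -> B b -> B (a - b).

Definition Zindependent (r : nat) (e : 'I_r -> A) : Prop :=
  forall c : 'I_r -> int, \sum_i e i *~ c i = 0 -> forall i, c i = 0.

Definition has_Zindependent (B : set A) (r : nat) : Prop :=
  exists e : 'I_r -> A, (forall i, B (e i)) /\ Zindependent e.

Definition is_rank (B : set A) (r : nat) : Prop :=
  has_Zindependent B r /\ forall s, has_Zindependent B s -> (s <= r)%N.

End AbelianGroups.

Section TwistedGroupAlgebras.
Variables (F : fieldType) (A : zmodType) (R : algType F).

Definition is_basis (bar : A -> R) : Prop :=
  (forall (s : seq A) (c : A -> F), uniq s ->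
     \sum_(a <- s) c a *: bar a = 0 -> forall a, a \in s -> c a = 0) /\
  (forall x : R, exists (s : seq A) (c : A -> F),
     x = \sum_(a <- s) c a *: bar a).

Definition is_twisted_group_algebra (tau : A -> A -> F) (bar : A -> R) : Prop :=
  [/\ forall a b, tau a b != 0,
      forall a b c, tau a b * tau (a + b) c = tau b c * tau a (b + c),
      is_basis bar
    & forall a b, bar a * bar b = tau a b *: bar (a + b)].

Definition twisted_sub (bar : A -> R) (B : set A) : set R :=
  [set x | exists (s : seq A) (c : A -> F),
     (forall a, ~ B a -> c a = 0) /\ x = \sum_(a <- s) c a *: bar a].

End TwistedGroupAlgebras.

Definition ring_center (R : nzRingType) : set R :=
  [set z | forall x, z * x = x * z].

Section Modules.
Variables (S : nzRingType) (V : lmodType S).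

Definition is_submodule (N : set V) : Prop :=
  N 0 /\ forall (a : S) u v, N u -> N v -> N (a *: u + v).

Definition is_simple : Prop :=
  (exists v : V, v != 0) /\
  forall N, is_submodule N -> N = [set 0] \/ N = [set: V].

(* dev_lt d L U: the poset of the submodules between L and U has deviation    *)
(* smaller than d, where a trivial poset has deviation smaller than 0 and a   *)
(* poset has deviation at most d when all but finitely many of the factors of *)
(* each of its descending chains have deviation smaller than d.               *)
Fixpoint dev_lt (d : nat) (L U : set V) : Prop :=
  if d is d'.+1 then
    forall N : nat -> set V,
      (forall i, [/\ is_submodule (N i), L `<=` N i & N i `<=` U]) ->
      (forall i, N i.+1 `<=` N i) ->
      exists m : nat, forall i, (m <= i)%N -> dev_lt d' (N i.+1) (N i)
  else U `<=` L.

Definition module_Krull_dim (d : nat) : Prop :=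
  dev_lt d.+1 [set 0] [set: V] /\ ~ dev_lt d [set 0] [set: V].

End Modules.

(* A right R-module is a left module over the converse ring R^c. *)
Definition ract (R : nzRingType) (M : lmodType R^c) (m : M) (x : R) : M :=
  (x : R^c) *: m.

(* Krull dimension (Rentschler-Gabriel) of R as a right module over itself. *)
Definition Krull_dim (R : nzRingType) (d : nat) : Prop :=
  module_Krull_dim (R^c)^o d.

Section GelfandKirillov.
Variables (F : fieldType) (R : algType F) (M : lmodType R^c).

(* The dimension over F of the span of s, which is the size of a maximal      *)
(* linearly independent subfamily; F acts on M through c |-> c%:A.            *)
Definition dim_span (s : seq M) : nat :=
  \max_(J : {set 'I_(size s)} |
          `[< forall c : 'I_(size s) -> F,
                \sum_(i in J) ract s`_i (c i)%:A = 0 ->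
                forall i, i \in J -> c i = 0 >]) #|J|.

(* If ms spans M0 and vs spans V, then growth_seq vs ms k spans               *)
(* M0 + M0 V + ... + M0 V^k.                                                  *)
Fixpoint growth_seq (vs : seq R) (ms : seq M) (k : nat) : seq M :=
  if k is k'.+1 then
    growth_seq vs ms k' ++ [seq ract m v | m <- growth_seq vs ms k', v <- vs]
  else ms.

(* The zero module is assigned dimension 0, because ln 0 = 0. *)
Definition GKdim (K : realType) : \bar K :=
  ereal_sup [set g | exists (vs : seq R) (ms : seq M),
    g = limn_esup (fun k : nat =>
          (ln (dim_span (growth_seq vs ms k))%:R / ln k%:R : K)%:E)].

End GelfandKirillov.

(* Main.v *)
Require Import Defs.
From HB Require Import structures.
From mathcomp Require Import all_boot all_order all_algebra.
From mathcomp Require Import all_classical all_reals all_analysis.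
From mathcomp Require Import zify ring.
From mathcomp Require Import -(notations) mpoly.

Set Implicit Arguments.
Unset Strict Implicit.
Unset Printing Implicit Defensive.

Import Order.TTheory GRing.Theory Num.Theory.
Import numFieldNormedType.Exports.

Local Open Scope classical_set_scope.
Local Open Scope ring_scope.

(* Write q(a, b) for the commutation factor of bar a and bar b, and n for the
   rank of A.

   If bar a - l lies in a maximal right ideal J, then the class u of 1 in R / J is
   an eigenvector of bar a, hence so are all the u (bar c), with eigenvalues
   q(c, a) l.  They are independent when q(., a) is injective on a subgroup C, so
   that the simple module R / J has Gelfand-Kirillov dimension at least rk C.
   It is therefore enough to find a whose centralizer has rank at most rk Z + 1.

   Order the monomials of positive exponents by degree and lexicographically.
   The leading monomials of a right ideal form an up-closed subset of N^n, and a
   descending chain of right ideals between L and U yields a descending chain of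
   up-closed sets between the corresponding ones.  If each nonzero factor U / L
   contained a 2-dimensional cone of leading monomials, the Krull dimension would
   be at most n - 2.  Hence some nonzero factor U / L has linear growth.

   Either U / L is finite-dimensional over F, or for some basis element a it is
   not F[bar a]-torsion; its rank r over F[bar a] is finite.  Then each bar c acts on
   F(bar a)^r by a semilinear map, and comparing the leading coefficients of the
   determinants of (bar c)(bar d) and (bar d)(bar c) gives q(c, d)^r = q(a, d)^k(c)
   for all c commuting with a and all d.  This forces the rank of the centralizer
   of a to be at most rk Z + 1. *)

(** * Up-closed sets of exponents *)

Notation "m +m p" := (mnm_add m p) (at level 50, left associativity).

Section NondecreasingSubsequences.

(** Every tail of [f] attains its minimum; [phi] picks such a minimum on the tail beyond its
    previous value. *)
Lemma nondecreasing_subsequence_nat (f : nat -> nat) :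
  exists2 phi : nat -> nat, {homo phi : i j / (i < j)%N} &
    {homo f \o phi : i j / (i <= j)%N}.
Proof.
have next N : exists m, (N <= m)%N /\ forall i, (N <= i)%N -> (f m <= f i)%N.
  have ex : exists v, `[< exists2 i, (N <= i)%N & f i = v >].
    by exists (f N); apply/asboolP; exists N.
  case: (ex_minnP ex) => v /asboolP[m Nm <-] minv; exists m; split=> // i Ni.
  by apply: minv; apply/asboolP; exists i.
have /choice[s sP] := next.
pose phi := fix phi k := if k is k'.+1 then s (phi k').+1 else s 0%N.
exists phi.
  by apply: homo_ltn => // [? ? ?|k]; [exact: ltn_trans|case: (sP (phi k).+1)].
apply: homo_leq => // [? ? ?|k]; first exact: leq_trans.
case: k => [|k] /=; first by have [_] := sP 0%N; apply.
have [_ min1] := sP (phi k).+1; apply: min1.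
by have [/ltnW le1 _] := sP (s (phi k).+1).+1; apply: leq_trans le1;
  case: (sP (phi k).+1).
Qed.

(* Dickson's lemma. *)
Lemma nondecreasing_subsequence n (f : nat -> multinom n) :
  exists2 phi : nat -> nat, {homo phi : i j / (i < j)%N} &
    forall l i j, (i <= j)%N -> (f (phi i) l <= f (phi j) l)%N.
Proof.
suff [phi phi_mono phiP] : exists2 phi : nat -> nat,
    {homo phi : i j / (i < j)%N} &
    forall l : 'I_n, l \in enum 'I_n ->
      forall i j, (i <= j)%N -> (f (phi i) l <= f (phi j) l)%N.
  by exists phi => // l; apply: phiP; rewrite mem_enum.
elim: (enum 'I_n) => [|l s [phi phi_mono phiP]]; first by exists id.
have [psi psi_mono psiP] := nondecreasing_subsequence_nat (fun i => f (phi i) l).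
exists (phi \o psi) => [i j ij|l']; first exact/phi_mono/psi_mono.
rewrite inE => /predU1P[->|l's] i j ij; first exact: psiP.
apply: phiP => //; apply: (homo_leq (r := leq)) ij => // [? ? ?|k].
  exact: leq_trans.
exact/ltnW/psi_mono.
Qed.

End NondecreasingSubsequences.

(** * Cones in differences of up-closed sets *)

Section Cones.
Variable n : nat.
Implicit Types (m p : multinom n) (I J : {set 'I_n}) (D V W : set (multinom n)).

Definition up_closed V := forall m p, V m -> V (m +m p).

(** The orthant p + N^I: coordinates in [I] are free, the others are fixed. *)
Definition cone p I : set (multinom n) :=
  [set m | (forall i, (p i <= m i)%N) /\ (forall i, i \notin I -> m i = p i)].

(** Shrinking [I] shrinks the cone, so cones of dimension above [g] are excluded as well. *)
Definition no_cone (g : nat) D := forall p I, #|I| = g -> ~ cone p I `<=` D.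

Lemma up_closedP V m p :
  up_closed V -> (forall i, (m i <= p i)%N) -> V m -> V p.
Proof.
move=> upV mp Vm; have -> : p = m +m mnm_sub p m; last exact: upV.
by apply/mnmP => i; rewrite mnmDE mnmBE subnKC.
Qed.

(** Otherwise each [T] has a counterexample. Along a nondecreasing subsequence, the first [m] lies
    below the [p] of any counterexample whose [T] is at least the degree of that [m]. *)
Lemma up_closed_truncation V : up_closed V ->
  exists T, forall m p, (forall i, (minn (m i) T <= p i)%N) -> V m -> V p.
Proof.
move=> upV; apply: contrapT => /forallNP noT.
have /choice[f fP] : forall T, exists mp : multinom n * multinom n,
    [/\ forall i, (minn (mp.1 i) T <= mp.2 i)%N, V mp.1 & ~ V mp.2].
  move=> T; apply: contrapT => /forallNP noV; apply: (noT T) => m p mp Vm.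
  by apply: contrapT => nVp; apply: (noV (m, p)).
have [phi phi_mono phiP] := nondecreasing_subsequence (fun k => (f k).1).
have phi_ge k : (k <= phi k)%N.
  by elim: k => // k IH; apply: leq_ltn_trans IH (phi_mono _ _ _).
pose t := mdeg (f (phi 0%N)).1.
have [le2 _ nV2] := fP (phi t); have [_ V1 _] := fP (phi 0%N).
apply: nV2; apply: up_closedP upV _ V1 => i; apply: leq_trans (le2 i).
rewrite leq_min phiP //=; apply: leq_trans (phi_ge t).
by rewrite /t mdegE (bigD1 i) //= leq_addr.
Qed.

(** Membership in [W] does not see how far an exponent exceeds [T], so raising exponents that have
    reached [T] cannot lead into [W]. *)
Lemma cone_truncation V W : up_closed V -> up_closed W ->
  exists T, forall m, V m -> ~ W m ->
    cone m [set i | (T <= m i)%N] `<=` V `\` W.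
Proof.
move=> upV upW; have [T WT] := up_closed_truncation upW.
exists T => m Vm nWm p [mp pm]; split; first exact: up_closedP upV mp Vm.
move=> Wp; apply: nWm; apply: WT Wp => i.
have [Tm|mT] := leqP T (m i); first by rewrite geq_min Tm orbT.
by rewrite pm ?inE -?ltnNge // geq_minl.
Qed.

Lemma cone_subset p I J : I \subset J -> cone p I `<=` cone p J.
Proof.
move=> /fintype.subsetP IJ m [pm mp]; split=> // i iJ; apply: mp.
by apply: contra iJ; apply: IJ.
Qed.

Lemma no_cone_card g D p I : no_cone g D -> cone p I `<=` D -> (#|I| < g)%N.
Proof.
move=> noD coneD; rewrite ltnNge; apply/negP => gI.
have [s [us ss sI]] : exists s : seq 'I_n, [/\ uniq s, size s = g & {subset s <= I}].
  exists (take g (enum I)); split; first by rewrite take_uniq ?enum_uniq.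
    by rewrite size_takel // -cardE.
  by move=> x /mem_take; rewrite mem_enum.
apply: (noD p [set i in s]); first by rewrite cardsE (card_uniqP us).
apply: subset_trans coneD; apply: cone_subset.
by apply/fintype.subsetP => i; rewrite inE; apply: sI.
Qed.

(** An exponent that reaches [T] would yield a 1-cone, so the difference lies in the box [0,
    T)^n. *)
Lemma no_cone1_count V W : up_closed V -> up_closed W ->
  no_cone 1 (V `\` W) ->
  exists C, forall s, uniq s ->
    (count (fun m => `[< V m /\ ~ W m >]) s <= C)%N.
Proof.
move=> upV upW noD; have [T TP] := cone_truncation upV upW.
exists #|{ffun 'I_n -> 'I_T.+1}| => s us; rewrite -size_filter.
pose g m := [ffun i => inord (m i) : 'I_T.+1] : {ffun 'I_n -> 'I_T.+1}.
have lt m : m \in [seq m <- s | `[< V m /\ ~ W m >]] -> forall i, (m i < T)%N.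
  rewrite mem_filter => /andP[/asboolP[Vm nWm] _] i; rewrite ltnNge; apply/negP => Ti.
  have := no_cone_card noD (TP m Vm nWm).
  by rewrite ltnS leqn0 cards_eq0 => /eqP/setP/(_ i); rewrite !inE Ti.
rewrite -(size_map g).
have /card_uniqP <- : uniq (map g [seq m <- s | `[< V m /\ ~ W m >]]).
  rewrite map_inj_in_uniq ?filter_uniq // => m p /lt ltm /lt ltp /ffunP gmp.
  apply/mnmP => i; have := congr1 val (gmp i).
  by rewrite !ffunE /= !inordK // ltnS ltnW.
exact: max_card.
Qed.

(** At most one exponent reaches [T], or there would be a 2-cone. A point is determined by the place
    of that exponent, its value up to [k], and the other exponents, all below [T]. *)
Lemma no_cone2_count V W : up_closed V -> up_closed W ->
  no_cone 2 (V `\` W) ->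
  exists C, forall k s, uniq s -> (forall m, m \in s -> (mdeg m <= k)%N) ->
    (count (fun m => `[< V m /\ ~ W m >]) s <= C * k.+1)%N.
Proof.
move=> upV upW noD; have [T TP] := cone_truncation upV upW.
exists #|{: option 'I_n * {ffun 'I_n -> 'I_T.+1}}| => k s us sk.
rewrite -size_filter.
pose big m := [pick i | (T <= m i)%N].
pose g m := ((big m, [ffun i => inord (minn (m i) T) : 'I_T.+1] :
  {ffun 'I_n -> 'I_T.+1}), inord (if big m is Some i then m i else 0%N) : 'I_k.+1).
have lt m : m \in [seq m <- s | `[< V m /\ ~ W m >]] ->
    forall i, big m != Some i -> (m i < T)%N.
  rewrite mem_filter => /andP[/asboolP[Vm nWm] _] i.
  rewrite /big; case: pickP => [j Tj ij|noT _]; last by rewrite ltnNge noT.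
  rewrite ltnNge; apply: contra ij => Ti; apply/eqP; congr Some.
  have := no_cone_card noD (TP m Vm nWm); rewrite ltnS => /card_le1_eqP; apply.
    by rewrite inE.
  by rewrite inE.
have lek m i : m \in [seq m <- s | `[< V m /\ ~ W m >]] -> (m i < k.+1)%N.
  rewrite mem_filter => /andP[_ /sk]; rewrite mdegE (bigD1 i) //= ltnS.
  exact/leq_trans/leq_addr.
have <- : #|{: option 'I_n * {ffun 'I_n -> 'I_T.+1} * 'I_k.+1}| =
   (#|{: option 'I_n * {ffun 'I_n -> 'I_T.+1}}| * k.+1)%N.
  by rewrite card_prod card_ord.
rewrite -(size_map g).
have /card_uniqP <- : uniq (map g [seq m <- s | `[< V m /\ ~ W m >]]).
  rewrite map_inj_in_uniq ?filter_uniq // => m p ms ps [bmp /ffunP gmp mpi].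
  apply/mnmP => i; have [bi|bi] := eqVneq (big m) (Some i).
    by move: mpi; rewrite -bmp bi => /(congr1 val) /=; rewrite !inordK ?lek.
  have := congr1 val (gmp i); rewrite !ffunE /= !inordK ?ltnS ?geq_minr //.
  by rewrite !(minn_idPl _) // ltnW // lt // -bmp.
exact: max_card.
Qed.

(** The sets N i \ N i.+1 are disjoint, but the g-cones in V \ W fall into finitely many classes
    such that two of the same class meet. So only finitely many steps can contain one. *)
Lemma descending_no_cone g V W (N : nat -> set (multinom n)) :
  up_closed V -> up_closed W -> no_cone g.+1 (V `\` W) ->
  (forall i, W `<=` N i /\ N i `<=` V) -> (forall i, N i.+1 `<=` N i) ->
  exists k, forall i, (k <= i)%N -> no_cone g (N i `\` N i.+1).
Proof.
move=> upV upW noD NVW Nd; have [T TP] := cone_truncation upV upW.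
have Nle i j : (i <= j)%N -> N j `<=` N i.
  by move=> /subnK<-; elim: (j - i)%N => [|k IH]//; exact: subset_trans (Nd _) IH.
pose bad i p := exists I,
  [/\ #|I| = g, cone p I `<=` N i `\` N i.+1 & I = [set j | (T <= p j)%N]%SET].
apply: contrapT => /forallNP noK.
have /choice[h hP] k : exists ip : nat * multinom n, (k <= ip.1)%N /\ bad ip.1 ip.2.
  have /existsNP[i /not_implyP[ki /existsNP[p /existsNP[I]]]] := noK k.
  move=> /not_implyP[cardI /contrapT coneN].
  (* The apex moves along its cone until the coordinates in [I] reach [T]. *)
  pose q := Multinom [tuple if j \in I then maxn (p j) T else p j | j < n].
  have qI : cone q I `<=` cone p I.
    move=> m [qm mq]; split=> j.
      apply: leq_trans (qm j); rewrite mnmE; case: ifP => // _.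
      exact: leq_maxl.
    by move=> jI; rewrite mq // mnmE (negPf jI).
  have coneq : cone q I `<=` N i `\` N i.+1 by apply: subset_trans coneN.
  have [Nq nNq] : (N i `\` N i.+1) q by apply: coneq; split.
  have IT : I \subset [set j | (T <= q j)%N]%SET.
    apply/fintype.subsetP => j jI; rewrite inE mnmE jI; exact: leq_maxr.
  exists (i, q); split=> //; exists I; split=> //.
  (* The coordinates of [q] that reach [T] span a cone in V \ W, of dimension at most [g]; hence
     they are exactly those in [I]. *)
  apply/eqP; rewrite eqEcard IT cardI -ltnS; apply: no_cone_card noD (TP q _ _).
    by apply: (NVW i).2.
  by move=> /(NVW i.+1).1.
pose t p := [ffun j => inord (minn (p j) T) : 'I_T.+1] : {ffun 'I_n -> 'I_T.+1}.
have inj i j p q : bad i p -> bad j q -> t p = t q -> (i < j)%N -> False.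
  move=> [I [_ Ip defI]] [J [_ Jq defJ]] /ffunP tpq ij.
  have mpq l : minn (p l) T = minn (q l) T.
    by have := congr1 val (tpq l); rewrite !ffunE /= !inordK ?ltnS ?geq_minr.
  have IJ : I = J.
    rewrite defI defJ; apply/setP => l; rewrite !inE.
    by have := mpq l; lia.
  (* Equal truncations give equal directions and equal fixed coordinates, so the join of the two
     apexes lies in both cones. *)
  pose m := Multinom [tuple maxn (p l) (q l) | l < n].
  have eqI l : l \notin I -> p l = q l.
    by move=> lI; have := mpq l; move: lI (lI); rewrite {1}defI IJ defJ !inE; lia.
  have [_ nNi] : (N i `\` N i.+1) m.
    apply: Ip; split=> l; rewrite mnmE ?leq_maxl// => /eqI ->.
    by rewrite maxnn.
  have [Nj _] : (N j `\` N j.+1) m.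
    apply: Jq; split=> l; rewrite mnmE ?leq_maxr// -IJ => /eqI ->.
    by rewrite maxnn.
  by apply: nNi; apply: Nle Nj.
pose ip := fix ip k := if k is k'.+1 then h (ip k').1.+1 else h 0%N.
have ip_mono : {homo (fun k => (ip k).1) : i j / (i < j)%N}.
  apply: homo_ltn => [? ? ?|k]; first exact: ltn_trans.
  by have [] := hP (ip k).1.+1.
have ipP k : bad (ip k).1 (ip k).2 by case: k => [|k] /=; apply: (hP _).2.
pose f (k : 'I_(#|{ffun 'I_n -> 'I_T.+1}|.+1)) := t (ip k).2.
have /injectiveP/injectivePn[k [l kl fkl]] : ~ injective f.
  by move=> /leq_card; rewrite card_ord ltnn.
have [kl'|lk|/val_inj eqkl] := ltngtP k l; last by rewrite eqkl eqxx in kl.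
  exact: inj (ipP k) (ipP l) fkl (ip_mono _ _ kl').
exact: inj (ipP l) (ipP k) (esym fkl) (ip_mono _ _ lk).
Qed.

End Cones.

(** * Twisted group algebras *)

Section TwistedGroupAlgebra.
Variables (F : fieldType) (A : zmodType) (R : algType F).
Variables (tau : A -> A -> F) (bar : A -> R).
Hypothesis tw : is_twisted_group_algebra tau bar.

Lemma tau_neq0 a b : tau a b != 0.
Proof. by case: tw. Qed.

Lemma bar_mul a b : bar a * bar b = tau a b *: bar (a + b).
Proof. by case: tw. Qed.

Lemma bar0 : bar 0 = tau 0 0 *: 1.
Proof.
have [_ cocycle [_ gen] _] := tw.
suff bar0l x : bar 0 * x = tau 0 0 *: x by rewrite -bar0l mulr1.
have tau0 a : tau 0 a = tau 0 0.
  have := cocycle 0 0 a; rewrite !add0r => /(mulIf (tau_neq0 _ _)).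
  by move->.
have [s [c ->]] := gen x; rewrite mulr_sumr scaler_sumr; apply: eq_bigr => a _.
by rewrite -scalerAr bar_mul add0r tau0 !scalerA mulrC.
Qed.

Definition ibar a := (tau a (- a) * tau 0 0)^-1 *: bar (- a).

Lemma bar_ibar a : bar a * ibar a = 1.
Proof.
rewrite -scalerAr bar_mul subrr bar0 !scalerA -mulrA mulVf ?scale1r //.
by rewrite mulf_neq0 ?tau_neq0.
Qed.

Lemma bar_neq0 a : bar a != 0.
Proof.
apply/eqP => a0; have /eqP := bar_ibar a.
by rewrite a0 mul0r eq_sym oner_eq0.
Qed.

Lemma bar_mul_neq0 a b : bar a * bar b != 0.
Proof. by rewrite bar_mul scaler_eq0 negb_or tau_neq0 bar_neq0. Qed.

Definition commutation a b := tau a b / tau b a.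
Local Notation q := commutation.

Lemma commutation_neq0 a b : q a b != 0.
Proof. by rewrite mulf_neq0 ?invr_eq0 ?tau_neq0. Qed.

Lemma bar_comm a b : bar a * bar b = q a b *: (bar b * bar a).
Proof. by rewrite !bar_mul scalerA addrC divfK ?tau_neq0. Qed.

Lemma commutationC a b : q a b * q b a = 1.
Proof. by rewrite /commutation mulrA divfK ?divff ?tau_neq0. Qed.

Lemma scale_inj (x : R) (k l : F) : x != 0 -> k *: x = l *: x -> k = l.
Proof.
move=> x0 /eqP; rewrite -subr_eq0 -scalerBl scaler_eq0 (negPf x0) orbF subr_eq0.
by move/eqP.
Qed.

Lemma commutationDl a b c : q (a + b) c = q a c * q b c.
Proof.
apply: (@scale_inj (bar c * (bar a * bar b))).
  by rewrite bar_mul -scalerAr scaler_eq0 negb_or tau_neq0 bar_mul_neq0.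
have -> : q (a + b) c *: (bar c * (bar a * bar b)) = bar a * bar b * bar c.
  by rewrite bar_mul -scalerAl bar_comm !scalerA -scalerAr scalerA mulrC.
rewrite -mulrA (bar_comm b c) -scalerAr (mulrA (bar a)) (bar_comm a c).
by rewrite -scalerAl scalerA mulrA [q b c * _]mulrC.
Qed.

Lemma commutation0l c : q 0 c = 1.
Proof.
apply: (mulIf (commutation_neq0 0 c)).
by rewrite mul1r -commutationDl addr0.
Qed.

Lemma commutationMn a c k : q (a *+ k) c = q a c ^+ k.
Proof.
elim: k => [|k IH]; first by rewrite mulr0n commutation0l.
by rewrite mulrS commutationDl IH exprS.
Qed.

Lemma commutationNl a c : q (- a) c = (q a c)^-1.
Proof.
apply: (mulIf (commutation_neq0 a c)).
by rewrite -commutationDl addNr commutation0l mulVf ?commutation_neq0.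
Qed.

Lemma commutationMz a c (k : int) : q (a *~ k) c = q a c ^ k.
Proof.
case: k => k; first by rewrite -pmulrn commutationMn.
by rewrite NegzE mulrNz commutationNl -pmulrn commutationMn.
Qed.

Lemma commutation_subl_eq1 a b c : q b a = 1 -> q c a = 1 -> q (b - c) a = 1.
Proof. by move=> ba ca; rewrite commutationDl commutationNl ba ca invr1 mulr1. Qed.

(** * Coordinates with respect to the basis *)

Lemma big_uniq_subset (s u : seq A) (f : A -> R) : uniq s -> uniq u ->
  {subset s <= u} -> (forall a, a \notin s -> f a = 0) ->
  \sum_(a <- u) f a = \sum_(a <- s) f a.
Proof.
move=> us uu su fs; rewrite (bigID (mem s)) /= [X in _ + X]big1 // addr0.
rewrite -big_filter; apply: perm_big; apply: uniq_perm => // [|a].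
  exact: filter_uniq.
by rewrite mem_filter; apply: andb_idr; apply: su.
Qed.

(** The expansions in [is_basis] may repeat an element of A; the repetitions are collected into one
    finitely supported function. *)
Lemma bcoef_subproof x : exists f : A -> F, exists s, [/\ uniq s,
  forall a, a \notin s -> f a = 0 & x = \sum_(a <- s) f a *: bar a].
Proof.
have [_ _ [_ gen] _] := tw; have [s [c ->]] := gen x.
exists (fun a => c a *+ count_mem a s), (undup s); split=> [|a|].
- exact: undup_uniq.
- by rewrite mem_undup => /count_memPn ->.
rewrite -big_undup_iterop_count; apply: eq_bigr => a _.
by rewrite Monoid.iteropE iter_addr addr0 scalerMnl.
Qed.

Definition bcoef x := sval (cid (bcoef_subproof x)).

Lemma bcoefP x : exists s, [/\ uniq s,
  forall a, a \notin s -> bcoef x a = 0 & x = \sum_(a <- s) bcoef x a *: bar a].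
Proof. exact: svalP (cid (bcoef_subproof x)). Qed.

Lemma bcoef_unique s f x : uniq s -> (forall a, a \notin s -> f a = 0) ->
  x = \sum_(a <- s) f a *: bar a -> bcoef x =1 f.
Proof.
move=> us fs xs a; have [s' [us' fs' xs']] := bcoefP x.
have [_ _ [free _] _] := tw; apply/eqP; rewrite -subr_eq0; apply/eqP.
pose u := undup (s ++ s').
have [au|] := boolP (a \in u); last first.
  by rewrite mem_undup mem_cat negb_or => /andP[/fs -> /fs' ->]; rewrite subrr.
apply: (free u (fun a => bcoef x a - f a)) au; first exact: undup_uniq.
rewrite (eq_bigr _ (fun a _ => scalerBl _ _ _)) sumrB.
rewrite (@big_uniq_subset s' u) ?undup_uniq //; last first.
- by move=> b /fs' ->; rewrite scale0r.
- by move=> b bs'; rewrite mem_undup mem_cat bs' orbT.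
rewrite (@big_uniq_subset s u) ?undup_uniq //; last first.
- by move=> b /fs ->; rewrite scale0r.
- by move=> b bs; rewrite mem_undup mem_cat bs.
by rewrite -xs -xs' subrr.
Qed.

Lemma bcoef_linear a k x y : bcoef (k *: x + y) a = k * bcoef x a + bcoef y a.
Proof.
have [s [us fs xs]] := bcoefP x; have [s' [us' fs' xs']] := bcoefP y.
pose u := undup (s ++ s').
apply: (@bcoef_unique u (fun a => k * bcoef x a + bcoef y a)).
- exact: undup_uniq.
- by move=> b; rewrite mem_undup mem_cat negb_or => /andP[/fs -> /fs' ->];
  rewrite mulr0 addr0.
rewrite {1}xs {1}xs' scaler_sumr.
rewrite -(@big_uniq_subset s u) ?undup_uniq //; last first.
- by move=> b /fs ->; rewrite scale0r scaler0.
- by move=> b bs; rewrite mem_undup mem_cat bs.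
rewrite -(@big_uniq_subset s' u) ?undup_uniq //; last first.
- by move=> b /fs' ->; rewrite scale0r.
- by move=> b bs'; rewrite mem_undup mem_cat bs' orbT.
by rewrite -big_split; apply: eq_bigr => b _; rewrite scalerDl scalerA.
Qed.

Lemma bcoef0 a : bcoef 0 a = 0.
Proof.
by apply: (@bcoef_unique [::] (fun=> 0)) => //; rewrite big_nil.
Qed.

Lemma bcoefD a x y : bcoef (x + y) a = bcoef x a + bcoef y a.
Proof. by rewrite -[x]scale1r bcoef_linear mul1r scale1r. Qed.

Lemma bcoefZ a k x : bcoef (k *: x) a = k * bcoef x a.
Proof. by rewrite -[_ *: _]addr0 bcoef_linear bcoef0 addr0. Qed.

Lemma bcoefB a x y : bcoef (x - y) a = bcoef x a - bcoef y a.
Proof. by rewrite -scaleN1r bcoefD bcoefZ mulN1r. Qed.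

Lemma bcoef_sum a I (s : seq I) (f : I -> R) :
  bcoef (\sum_(i <- s) f i) a = \sum_(i <- s) bcoef (f i) a.
Proof. by apply: (big_morph (bcoef^~ a)) => [x y|]; rewrite ?bcoefD ?bcoef0. Qed.

Lemma bcoef_bar a b : bcoef (bar b) a = (a == b)%:R.
Proof.
apply: (@bcoef_unique [:: b] (fun a => (a == b)%:R)) => // [c|].
  by rewrite inE => /negPf ->.
by rewrite big_seq1 eqxx scale1r.
Qed.

Lemma bcoef_eq0 x : (forall a, bcoef x a = 0) -> x = 0.
Proof.
move=> x0; have [s [_ _ ->]] := bcoefP x.
by rewrite big1 // => a _; rewrite x0 scale0r.
Qed.

Lemma bcoef_mul_bar x a b : bcoef (x * bar b) (a + b) = tau a b * bcoef x a.
Proof.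
have [s [us fs xs]] := bcoefP x.
rewrite {1}xs mulr_suml bcoef_sum.
under eq_bigr => c _ do rewrite -scalerAl bar_mul !bcoefZ bcoef_bar (inj_eq (addIr _)).
have [as_|as'] := boolP (a \in s).
  rewrite (bigD1_seq a) //= eqxx big1 /= => [|c /negPf ca];
    first by rewrite addr0 mulr1 mulrC.
  by rewrite eq_sym ca !mulr0.
rewrite (fs _ as') mulr0 big_seq big1 // => c cs.
have [ac|] := eqVneq a c; last by rewrite !mulr0.
by move: as'; rewrite ac cs.
Qed.

Lemma bcoef_bar_mul x a b : bcoef (bar a * x) (a + b) = tau a b * bcoef x b.
Proof.
have [s [us fs xs]] := bcoefP x.
rewrite {1}xs mulr_sumr bcoef_sum.
under eq_bigr => c _ do rewrite -scalerAr bar_mul !bcoefZ bcoef_bar (inj_eq (addrI _)).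
have [as_|as'] := boolP (b \in s).
  rewrite (bigD1_seq b) //= eqxx big1 /= => [|c /negPf ca];
    first by rewrite addr0 mulr1 mulrC.
  by rewrite eq_sym ca !mulr0.
rewrite (fs _ as') mulr0 big_seq big1 // => c cs.
have [ac|] := eqVneq b c; last by rewrite !mulr0.
by move: as'; rewrite ac cs.
Qed.

Lemma bcoef_finite x : exists s : seq A, forall a, bcoef x a != 0 -> a \in s.
Proof.
have [s [_ fs _]] := bcoefP x; exists s => a; apply: contraNT => /fs ->.
exact: eqxx.
Qed.

Lemma center_bar Z c : @ring_center R = twisted_sub bar Z ->
  (forall d, q c d = 1) -> Z c.
Proof.
move=> centerZ cq; have : twisted_sub bar Z (bar c).
  rewrite -centerZ /= => x; have [s [_ _ ->]] := bcoefP x.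
  rewrite mulr_sumr mulr_suml; apply: eq_bigr => a _.
  by rewrite -scalerAr bar_comm cq scale1r scalerAl.
move=> [s [f [fZ cs]]]; apply: contrapT => nZc.
have : bcoef (bar c) c = 0.
  rewrite cs bcoef_sum big1 // => a _; rewrite bcoefZ bcoef_bar.
  have [<-|] := eqVneq c a; last by rewrite mulr0.
  by rewrite fZ ?mul0r.
by rewrite bcoef_bar eqxx => /eqP; rewrite oner_eq0.
Qed.

End TwistedGroupAlgebra.

(** * Leading monomials and Krull dimension *)

(** Up to conversion this is [is_submodule] for the regular module of the converse ring, so the
    chains in [dev_lt] consist of right ideals. *)
Definition right_ideal (R : nzRingType) (L : set R) : Prop :=
  L 0 /\ forall x u v, L u -> L v -> L (u * x + v).

Section RightIdeals.
Variables (F : fieldType) (R : algType F) (L : set R).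
Hypothesis L_ideal : right_ideal L.

Lemma right_ideal0 : L 0.
Proof. by case: L_ideal. Qed.

Lemma right_idealM u x : L u -> L (u * x).
Proof. by case: L_ideal => L0 LD Lu; rewrite -[_ * _]addr0; apply: LD. Qed.

Lemma right_idealD u v : L u -> L v -> L (u + v).
Proof. by case: L_ideal => L0 LD Lu Lv; rewrite -[u]mulr1; apply: LD. Qed.

Lemma right_idealZ k u : L u -> L (k *: u).
Proof. by move=> /(right_idealM k%:A); rewrite -scalerAr mulr1. Qed.

Lemma right_idealB u v : L u -> L v -> L (u - v).
Proof. by move=> Lu Lv; rewrite -scaleN1r; apply/right_idealD/right_idealZ. Qed.

Lemma right_idealBr u v : L (u - v) -> L v -> L u.
Proof. by move=> /right_idealD Luv /Luv; rewrite subrK. Qed.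

Lemma right_ideal_sum I (s : seq I) (f : I -> R) :
  (forall i, L (f i)) -> L (\sum_(i <- s) f i).
Proof.
move=> Lf; elim/big_ind: _ => //; first exact: right_ideal0.
exact: right_idealD.
Qed.

End RightIdeals.

Lemma row_kernel (F : fieldType) (I : finType) h (f : I -> 'I_h -> F) :
  (h < #|I|)%N ->
  exists c : I -> F, (exists i, c i != 0) /\ forall j, \sum_i c i * f i j = 0.
Proof.
move=> hI; pose M := \matrix_(i < #|I|, j < h) f (enum_val i) j.
have : kermx M != 0.
  by rewrite -mxrank_eq0 mxrank_ker -lt0n subn_gt0 (leq_ltn_trans (rank_leq_col _)).
case/rowV0Pn => v /sub_kermxP vM v0; exists (fun i => v 0 (enum_rank i)); split.
  have /rV0Pn[i vi] := v0; exists (enum_val i); by rewrite enum_valK.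
move=> j; have /rowP/(_ j) := vM; rewrite !mxE; apply: etrans.
rewrite (reindex (@enum_val I I)) /=; last by apply: onW_bij; apply: enum_val_bij.
by apply: eq_bigr => i _; rewrite enum_valK mxE.
Qed.

Section LeadingMonomials.
Variables (F : fieldType) (A : zmodType) (R : algType F).
Variables (tau : A -> A -> F) (bar : A -> R).
Hypothesis tw : is_twisted_group_algebra tau bar.
Variables (n : nat) (e : 'I_n -> A).
Hypothesis e_basis : forall a : A, exists! c : 'rV[int]_n, a = \sum_i e i *~ c 0 i.
Local Notation cf := (bcoef tw).
Implicit Types (L U : set R) (m p : multinom n).

Definition monomial m : A := \sum_i e i *+ m i.

Lemma monomialD m p : monomial (m +m p) = monomial m + monomial p.
Proof.
rewrite /monomial -big_split; apply: eq_bigr => i _.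
by rewrite mnmDE mulrnDr.
Qed.

Lemma monomial1 i : monomial (mnm1 i) = e i.
Proof.
rewrite /monomial (bigD1 i) //= big1 => [|j /negPf ij]; rewrite mnm1E ?eqxx ?addr0//.
by rewrite eq_sym ij.
Qed.

Lemma monomial_inj : injective monomial.
Proof.
move=> m p mp; have [c [_ c_uniq]] := e_basis (monomial m).
have cE q : monomial q = monomial m -> c = \row_i (q i)%:Z.
  by move=> qm; apply: c_uniq; rewrite -qm; apply: eq_bigr => i _; rewrite mxE -pmulrn.
apply/mnmP => i.
have /rowP/(_ i) := cE m erefl; rewrite (cE p (esym mp)) !mxE => /eqP.
by rewrite eqz_nat => /eqP.
Qed.

Lemma monomial_diff a : exists p m, a + monomial p = monomial m.
Proof.
have [c [-> _]] := e_basis a.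
exists (Multinom [tuple absz (c 0 i) | i < n]).
exists (Multinom [tuple absz (c 0 i + (absz (c 0 i))%:Z) | i < n]).
rewrite /monomial -big_split; apply: eq_bigr => i _; rewrite !mnmE /= !pmulrn.
by rewrite -mulrzDr; congr (_ *~ _); lia.
Qed.

(** The order on exponents compares degrees first. An element with a negative exponent in its
    support leads at no [m]. *)
Definition leads x m : Prop :=
  cf x (monomial m) != 0 /\
  forall a, cf x a != 0 -> exists p, (p <= m)%O /\ a = monomial p.

(** Only elements with non-negative exponents contribute; multiplication by a suitable monomial, a
    unit, brings any element into this form. *)
Definition lead_set L : set (multinom n) := [set m | exists x, L x /\ leads x m].

Lemma leadsM x m p : leads x m -> leads (x * bar (monomial p)) (m +m p).
Proof.
move=> [xm xle]; rewrite /leads monomialD bcoef_mul_bar mulf_neq0 ?(tau_neq0 tw) //.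
split=> // a; rewrite -{1}[a](subrK (monomial p)) bcoef_mul_bar mulf_eq0 negb_or.
move=> /andP[_ /xle[m' [m'm am']]]; exists (m' +m p); rewrite lemc_add2l.
by rewrite monomialD -am' subrK.
Qed.

Lemma lead_set_up_closed L : right_ideal L -> up_closed (lead_set L).
Proof.
move=> idL m p [x [Lx xm]]; exists (x * bar (monomial p)).
by split; [exact: (right_idealM idL)|exact: leadsM].
Qed.

Lemma lead_setS L U : L `<=` U -> lead_set L `<=` lead_set U.
Proof. by move=> LU m [x [/LU Ux xm]]; exists x. Qed.

Definition supported (S : pred (multinom n)) x : Prop :=
  forall a, cf x a != 0 -> exists m, S m /\ a = monomial m.

(** Gaussian elimination from the greatest monomial down. The common kernel of the functionals lies
    in [L], so the elements of [U] supported on [s] have dimension modulo [L] at most the number of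
    functionals. *)
Lemma quotient_functionals L U (s : seq (multinom n)) :
  right_ideal L -> right_ideal U -> L `<=` U ->
  sorted (fun m p => p < m)%O s ->
  (forall m p, m \in s -> (p <= m)%O -> p \in s) ->
  exists phi : nat -> R -> F,
    (forall j k x y, phi j (k *: x + y) = k * phi j x + phi j y) /\
    forall x, U x -> supported [in s] x ->
      (forall j, (j < count (fun m => `[< lead_set U m /\ ~ lead_set L m >]) s)%N ->
        phi j x = 0) -> L x.
Proof.
move=> idL idU LU; elim: s => [|m s IH] ssort sdown.
  exists (fun _ _ => 0); split=> [*|x _ xs _]; first by rewrite mulr0 addr0.
  suff -> : x = 0 by exact: right_ideal0.
  by apply: (bcoef_eq0 (tw := tw)) => a; apply/eqP; apply: contraT => /xs[? []].
have s_lt p : p \in s -> (p < m)%O.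
  by apply/allP: p; apply: order_path_min ssort => ? ? ? /[swap]; apply: lt_trans.
have [] := IH.
- by move: ssort => /=; apply: path_sorted.
- move=> p p' ps p'p; have := sdown p p'; rewrite !inE ps orbT => /(_ isT p'p).
  case/predU1P => // p'm; have := s_lt p ps.
  by rewrite -p'm => /(le_lt_trans p'p); rewrite ltxx.
move=> phi [phi_lin phiP].
have supp_tail x : supported [in m :: s] x -> cf x (monomial m) = 0 ->
    supported [in s] x.
  move=> xs xm a /[dup] xa /xs[p [ps ap]]; exists p; split=> //.
  move: ps; rewrite inE => /predU1P[pm|//].
  by move: xa; rewrite ap pm xm eqxx.
(* The coefficient at [m] is cleared by subtracting a multiple of an element of [L], at no cost in
   functionals. *)
have [Lm|nLm] := pselect (lead_set L m).
  have [l [Ll [lm lle]]] := Lm.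
  pose r x := x - (cf x (monomial m) / cf l (monomial m)) *: l.
  have rlin k x y : r (k *: x + y) = k *: r x + r y.
    rewrite /r bcoef_linear mulrDl scalerDl scalerBr scalerA mulrA opprD.
    by rewrite addrACA.
  exists (fun j x => phi j (r x)); split=> [j k x y|x Ux xs xphi].
    by rewrite rlin phi_lin.
  have Lrx : L (r x).
    apply: phiP => [||j js].
    - by apply: (right_idealB idU) => //; apply: (right_idealZ idU); apply: LU.
    - apply: supp_tail; last by rewrite /r bcoefB bcoefZ divfK ?subrr.
      move=> a; rewrite bcoefB bcoefZ.
      have [->|/lle[p [pm ap]] _] := eqVneq (cf l a) 0.
        by rewrite mulr0 subr0; apply: xs.
      by exists p; split=> //; apply: (sdown m) => //; rewrite mem_head.
    - apply: xphi => /=; case: asboolP => [[]//|_]; exact: js.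
  by apply: (right_idealBr idL) Lrx _; apply: (right_idealZ idL).
(* Here [m] is counted, and the coefficient at [m] becomes the new functional. *)
have [Um|nUm] := pselect (lead_set U m).
  exists (fun j x => if j is j'.+1 then phi j' x else cf x (monomial m)).
  split=> [[|j] k x y //|x Ux xs xphi].
    exact: bcoef_linear.
  have Dm : `[< lead_set U m /\ ~ lead_set L m >] by apply/asboolP.
  apply: phiP => // [|j js]; last by apply: (xphi j.+1); rewrite /= Dm.
  by apply: supp_tail => //; apply: (xphi 0%N); rewrite /= Dm.
(* Now the coefficient at [m] vanishes by itself, or [x] would lead at [m]. *)
exists phi; split=> // x Ux xs xphi; apply: phiP => // [|j js].
  apply: supp_tail => //; apply/eqP; apply: contraT => xm.
  exfalso; apply: nUm; exists x; split=> //; split=> // a /xs[p [ps ap]].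
  exists p; split=> //; move: ps; rewrite inE => /predU1P[->//|/s_lt].
  exact: ltW.
by apply: xphi => /=; case: asboolP => [[]//|_]; exact: js.
Qed.

(** Listed in decreasing order, as the elimination in [quotient_functionals] requires. *)
Definition monomials_upto k : seq (multinom n) :=
  rev (sort <=%O [seq bmnm m | m : bmultinom n k.+1]).

Lemma mem_monomials_upto k m : (m \in monomials_upto k) = (mdeg m <= k)%N.
Proof.
rewrite mem_rev mem_sort; apply/mapP/idP => [[p _ ->]|mk]; first by rewrite -ltnS bmdeg.
by exists (BMultinom (mk : (mdeg m < k.+1)%N)); rewrite ?mem_enum.
Qed.

Lemma monomials_upto_uniq k : uniq (monomials_upto k).
Proof. by rewrite rev_uniq sort_uniq map_inj_uniq ?enum_uniq //; apply: val_inj. Qed.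

Definition quotient_count L U k : nat :=
  count (fun m => `[< lead_set U m /\ ~ lead_set L m >]) (monomials_upto k).

Definition degree_le k x := supported (fun m => mdeg m <= k)%N x.

(** More elements than functionals have a nontrivial combination on which all the functionals
    vanish. *)
Lemma quotient_dependent L U k (I : finType) (y : I -> R) :
  right_ideal L -> right_ideal U -> L `<=` U ->
  (forall i, U (y i)) -> (forall i, degree_le k (y i)) ->
  (quotient_count L U k < #|I|)%N ->
  exists c : I -> F, (exists i, c i != 0) /\ L (\sum_i c i *: y i).
Proof.
move=> idL idU LU Uy yk lt_count.
have [||phi [phi_lin phiP]] :=
  @quotient_functionals L U (monomials_upto k) idL idU LU.
- by rewrite rev_sorted sort_lt_sorted map_inj_uniq ?enum_uniq //; apply: val_inj.
- by move=> m p; rewrite !mem_monomials_upto => mk /lemc_mdeg /leq_trans; apply.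
have [c [c0 cphi]] :=
  @row_kernel F I (quotient_count L U k) (fun i j => phi j (y i)) lt_count.
exists c; split=> //; apply: phiP.
- by apply: (right_ideal_sum idU) => i; apply: (right_idealZ idU).
- move=> a; rewrite bcoef_sum => /eqP sum0.
  have [[i yi]|noi] := pselect (exists i, cf (y i) a != 0).
    have [m [mk am]] := yk i a yi.
    by exists m; split=> //; rewrite /= mem_monomials_upto.
  exfalso; apply: sum0; rewrite big1 // => i _; rewrite bcoefZ.
  by have [->|yi] := eqVneq (cf (y i) a) 0; [rewrite mulr0|case: noi; exists i].
move=> j js; rewrite -[RHS](cphi (Ordinal js)).
have phi0 : phi j 0 = 0.
  by apply: (addIr (phi j 0)); rewrite -{1}[phi j 0]mul1r -phi_lin add0r scale1r add0r.
apply: (big_ind2 (fun u v => phi j u = v)) => // [x1 x2 y1 y2 <- <-|i _].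
  by rewrite -[x1]scale1r phi_lin mul1r scale1r.
by rewrite -[_ *: _]addr0 phi_lin phi0 addr0.
Qed.

(** Each level of the deviation lowers the excluded dimension by one, through [descending_no_cone].
    The hypothesis ends the induction two dimensions early, hence the shift from [d] to [d.+2]. *)
Lemma no_cone2_dev_lt :
  (forall L U, right_ideal L -> right_ideal U -> L `<=` U ->
    no_cone 2 (lead_set U `\` lead_set L) -> U `<=` L) ->
  forall d L U, right_ideal L -> right_ideal U -> L `<=` U ->
    no_cone d.+2 (lead_set U `\` lead_set L) ->
    @dev_lt R^c (R^c)^o d L U.
Proof.
move=> base; elim=> [|d IH] L U idL idU LU noD /=; first exact: base.
move=> N NLU Nd.
have [k kP] := @descending_no_cone _ d.+2 (lead_set U) (lead_set L)
  (fun i => lead_set (N i)) (lead_set_up_closed idU) (lead_set_up_closed idL) noD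
  (fun i => let: And3 _ LN NU := NLU i in conj (lead_setS LN) (lead_setS NU))
  (fun i => lead_setS (Nd i)).
exists k => i ki; apply: IH => //; last exact: kP.
  by case: (NLU i.+1).
by case: (NLU i).
Qed.

Lemma Krull_factor d : (n <= d.+1)%N ->
  ~ @dev_lt R^c (R^c)^o d [set 0] [set: R] ->
  exists L U, [/\ right_ideal L, right_ideal U, L `<=` U, ~ U `<=` L &
    no_cone 2 (lead_set U `\` lead_set L)].
Proof.
move=> nd ndev; apply: contrapT => noLU; apply: ndev; apply: no_cone2_dev_lt.
- move=> L U idL idU LU noD; apply: contrapT => UL; apply: noLU.
  by exists L, U.
- by split=> // x u v -> ->; rewrite mul0r addr0.
- by split.
- by [].
(* A cone of dimension d + 2 does not fit into N^n. *)
- move=> p I cardI; have := max_card I.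
  by rewrite cardI card_ord ltnNge nd.
Qed.

End LeadingMonomials.

(** * The determinant relation *)

(** The action is arbitrary because the scalars will be a field, a polynomial ring or the
    integers. *)
Definition independent_over (V P : zmodType) (act : V -> P -> V) (L : set V) r
    (E : 'I_r -> V) : Prop :=
  forall f : 'I_r -> P, L (\sum_i act (E i) (f i)) -> forall i, f i = 0.

(** Spanning up to torsion: only some nonzero multiple of [v] is a combination modulo [L]. *)
Definition spanning_over (V P : zmodType) (act : V -> P -> V) (L U : set V) r
    (E : 'I_r -> V) : Prop :=
  forall v, U v -> exists p (f : 'I_r -> P),
    p != 0 /\ L (act v p - \sum_i act (E i) (f i)).

(** A family of maximal size spans, because adjoining any [v] makes it dependent. The family [E0]
    gives the lower bound on [r]. *)
Lemma maximal_independent (V P : zmodType) (act : V -> P -> V)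
    (L U : set V) C r0 (E0 : 'I_r0 -> V) :
  (forall v, act v 0 = 0) -> (forall v p, act v (- p) = - act v p) ->
  (forall i, U (E0 i)) -> independent_over act L E0 ->
  (forall r (E : 'I_r -> V), (forall i, U (E i)) -> independent_over act L E ->
    (r <= C)%N) ->
  exists r (E : 'I_r -> V), [/\ (r0 <= r)%N, forall i, U (E i),
    independent_over act L E & spanning_over act L U E].
Proof.
move=> act0 actN UE0 indE0 bound.
pose Q r := `[< exists E : 'I_r -> V,
  (forall i, U (E i)) /\ independent_over act L E >].
have Q0 : Q r0 by apply/asboolP; exists E0.
have QC r : Q r -> (r <= C)%N.
  by move=> /asboolP[E [UE indE]]; exact: (bound r E).
case: (ex_maxnP (ex_intro Q r0 Q0) QC) => r /asboolP[E [UE indE]] maxr.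
exists r, E; split=> // [|v Uv]; first exact: maxr.
pose E' (i : 'I_r.+1) := if unlift ord_max i is Some j then E j else v.
have UE' i : U (E' i) by rewrite /E'; case: unliftP.
have : ~ independent_over act L E'.
  move=> indE'; have /maxr : Q r.+1 by apply/asboolP; exists E'.
  by rewrite ltnn.
move=> /existsNP[f /not_implyP[Lf /existsNP[i fi]]].
have widenE (j : 'I_r) : widen_ord (leqnSn r) j = lift ord_max j.
  by apply: val_inj; rewrite /= /bump leqNgt ltn_ord.
move: Lf; rewrite big_ord_recr /= {2}/E' unlift_none.
under eq_bigr => j _ do rewrite widenE /E' liftK.
move=> Lf; exists (f ord_max), (fun j => - f (lift ord_max j)).
split; last first.
  by under eq_bigr => j _ do rewrite actN; rewrite sumrN opprK addrC.
(* A zero coefficient at [v] would leave a relation among the [E i] alone. *)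
apply/eqP => fmax; apply: fi; move: Lf; rewrite fmax act0 addr0.
move=> /(indE (fun j => f (lift ord_max j))) fw.
by case: (unliftP ord_max i) => [j|] ->.
Qed.

Definition independent_mod (R P : nzRingType) (phi : P -> R) :=
  independent_over (fun x p => x * phi p).

Definition spanning_mod (R P : nzRingType) (phi : P -> R) :=
  spanning_over (fun x p => x * phi p).

(** * Determinants of semilinear actions *)

Section DeterminantRelation.
Variables (F : fieldType) (A : zmodType) (R : algType F).
Variables (tau : A -> A -> F) (bar : A -> R).
Hypothesis tw : is_twisted_group_algebra tau bar.
Local Notation q := (commutation tau).

(** Two instances occur: [P] = F with trivial twists, and [P] = F[X], where X acts as bar of a basis
    element and [sigma d] rescales X. *)
Variables (P : idomainType) (phi : {rmorphism P -> R}).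
Variables (iota : {rmorphism F -> P}) (sigma : A -> {rmorphism P -> P}).
Hypothesis phi_iota : forall k, phi (iota k) = k%:A.
Hypothesis phi_bar : forall f d, phi f * bar d = bar d * phi (sigma d f).
Hypothesis sigma_inj : forall d, injective (sigma d).

Variables (L U : set R) (r : nat) (E : 'I_r -> R).
Hypotheses (L_ideal : right_ideal L) (U_ideal : right_ideal U).
Hypothesis E_U : forall i, U (E i).
Hypothesis E_independent : independent_mod phi L E.
Hypothesis E_spanning : spanning_mod phi L U E.

Local Notation "u == v" := (L (u - v)) (at level 70, only parsing).

Let comb (M : 'M[P]_r) i := \sum_j E j * phi (M j i).

Let eqv_trans v u w : u == v -> v == w -> u == w.
Proof. by move=> uv /(right_idealD L_ideal uv); rewrite addrA subrK. Qed.

Let eqv_mul x u v : u == v -> u * x == v * x.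
Proof. by rewrite -mulrBl => /(right_idealM L_ideal); apply. Qed.

Let eqv_sum (f g : 'I_r -> R) : (forall i, f i == g i) ->
  \sum_i f i == \sum_i g i.
Proof. by rewrite -sumrB => fg; apply: right_ideal_sum. Qed.

Let eqv_sym u v : u == v -> v == u.
Proof. by move=> /(right_idealZ L_ideal (-1)); rewrite scaleN1r opprB. Qed.

Let comb_scale (M : 'M[P]_r) f i : comb M i * phi f = comb (f *: M) i.
Proof.
rewrite /comb mulr_suml; apply: eq_bigr => j _.
by rewrite mxE -mulrA -rmorphM mulrC.
Qed.

Let comb_inj (M N : 'M[P]_r) : (forall i, comb M i == comb N i) -> M = N.
Proof.
move=> MN; apply/matrixP => j i; apply/eqP; rewrite -subr_eq0; apply/eqP.
have := @E_independent (fun j => M j i - N j i); apply; have := MN i.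
rewrite /comb -sumrB; congr (L _); apply: eq_bigr => k _.
by rewrite rmorphB mulrBr.
Qed.

(** The product of the separate denominators is a common one, so that bar c acts on the family by a
    matrix over one denominator. *)
Let transition c : exists pM : P * 'M[P]_r, pM.1 != 0 /\
  forall i, E i * bar c * phi pM.1 == comb pM.2 i.
Proof.
have /choice[pf pfP] i : exists pf : P * ('I_r -> P), pf.1 != 0 /\
    E i * bar c * phi pf.1 == \sum_j E j * phi (pf.2 j).
  have [p [f [p0 Lf]]] := E_spanning (right_idealM U_ideal (bar c) (E_U i)).
  by exists (p, f).
exists (\prod_i (pf i).1,
  \matrix_(j, i) ((pf i).2 j * \prod_(k | k != i) (pf k).1)); split=> [|i] /=.
  by apply/prodf_neq0 => i _; case: (pfP i).
have [_ /(eqv_mul (phi (\prod_(k | k != i) (pf k).1)))] := pfP i.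
rewrite -(mulrA _ (phi _) (phi _)) -rmorphM mulr_suml.
rewrite [X in _ -> L (_ * phi X - _)](bigD1 i) //=; congr (L (_ - _)).
by apply: eq_bigr => j _; rewrite mxE rmorphM mulrA.
Qed.

Let p c := (sval (cid (transition c))).1.
Let T c := (sval (cid (transition c))).2.

Let p_neq0 c : p c != 0.
Proof. by case: (svalP (cid (transition c))). Qed.

Let T_eqv c i : E i * bar c * phi (p c) == comb (T c) i.
Proof. by case: (svalP (cid (transition c))). Qed.

Let scale c d := sigma d (p c) * p d.

Let scale_neq0 c d : scale c d != 0.
Proof.
by rewrite mulf_neq0 ?p_neq0 // -(rmorph0 (sigma d)) (inj_eq (@sigma_inj d)) p_neq0.
Qed.

(** Moving bar d past a coefficient twists it by [sigma d], so the matrices multiply semilinearly,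
    with denominator [scale c d]. *)
Let T_mul c d i : E i * bar c * bar d * phi (scale c d) ==
  comb (T d *m map_mx (sigma d) (T c)) i.
Proof.
apply: (@eqv_trans (\sum_k E k * bar d * phi (p d) * phi (sigma d (T c k i)))).
  have := eqv_mul (bar d * phi (p d)) (T_eqv c i).
  congr (L (_ - _)).
    rewrite -!mulrA [phi (p c) * _]mulrA phi_bar -!mulrA -rmorphM.
    by rewrite [scale c d]/scale.
  rewrite /comb mulr_suml; apply: eq_bigr => k _.
  rewrite -!mulrA [phi (T c k i) * _]mulrA phi_bar -!mulrA -!rmorphM.
  by rewrite [p d * _]mulrC.
have -> : comb (T d *m map_mx (sigma d) (T c)) i =
    \sum_k comb (T d) k * phi (sigma d (T c k i)).
  rewrite /comb; under [RHS]eq_bigr => k _ do rewrite mulr_suml.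
  rewrite exchange_big /=; apply: eq_bigr => j _.
  rewrite mxE rmorph_sum mulr_sumr; apply: eq_bigr => k _.
  by rewrite mxE rmorphM mulrA.
by apply: eqv_sum => k; apply: eqv_mul; apply: T_eqv.
Qed.

Let scalarE k x f : x * (phi (iota k) * f) = k *: (x * f) :> R.
Proof. by rewrite phi_iota -scalerAl mul1r -scalerAr. Qed.

(** The product of bar c and bar (- c) is a nonzero scalar, so T (- c) times the twisted T c is a
    nonzero scalar matrix. *)
Let det_T_neq0 c : \det (T c) != 0.
Proof.
pose k := tau c (- c) * tau 0 0.
have k0 : k != 0 by rewrite mulf_neq0 ?(tau_neq0 tw).
have /(congr1 determinant) : T (- c) *m map_mx (sigma (- c)) (T c) =
    (iota k * scale c (- c))%:M.
  apply: comb_inj => i; apply: eqv_trans (eqv_sym (T_mul _ _ _)) _.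
  rewrite /comb (bigD1 i) //= big1 => [|j /negPf ji]; last first.
    by rewrite mxE ji rmorph0 mulr0.
  rewrite mxE eqxx addr0 mulr1n rmorphM scalarE -(mulrA (E i)) (bar_mul tw) subrr.
  rewrite (bar0 tw) scalerA -/k -scalerAr mulr1 scalerAl subrr.
  exact: right_ideal0.
rewrite det_mulmx det_scalar det_map_mx => detT.
apply: contraTneq isT => detT0; move: detT.
rewrite detT0 rmorph0 mulr0 => /esym/eqP; rewrite expf_eq0 mulf_eq0 fmorph_eq0.
by rewrite (negPf k0) (negPf (scale_neq0 _ _)) andbF.
Qed.

Lemma det_relation : exists D p : A -> P,
  (forall c, D c != 0 /\ p c != 0) /\
  forall c d, iota (q c d) ^+ r * D c * sigma c (D d) * (sigma d (p c) * p d) ^+ r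
    = D d * sigma d (D c) * (sigma c (p d) * p c) ^+ r.
Proof.
exists (fun c => \det (T c)), p; split=> [c|c d]; first by rewrite det_T_neq0 p_neq0.
(* Both sides represent bar c bar d = q(c, d) bar d bar c, each multiplied by the denominator of the
   other; determinants turn the scalars into r-th powers. *)
have /(congr1 determinant) :
    (iota (q c d) * scale c d) *: (T c *m map_mx (sigma c) (T d)) =
    scale d c *: (T d *m map_mx (sigma d) (T c)).
  apply: comb_inj => i; rewrite -!comb_scale.
  have := eqv_mul (phi (scale d c)) (T_mul c d i).
  have := eqv_mul (phi (iota (q c d) * scale c d)) (T_mul d c i).
  move=> /eqv_sym dc cd; apply: eqv_trans dc _; apply: eqv_trans cd.
  have -> : E i * bar d * bar c * phi (scale d c) * phi (iota (q c d) * scale c d) =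
      q c d *: (E i * (bar d * bar c) * phi (scale c d * scale d c)).
    by rewrite rmorphM scalarE -mulrA -rmorphM [scale d c * _]mulrC mulrA.
  rewrite -(mulrA (E i) (bar c)) (bar_comm tw c d) -scalerAr -!scalerAl.
  by rewrite -(mulrA _ (phi _) (phi _)) -rmorphM subrr; apply: right_ideal0.
rewrite !detZ !det_mulmx !det_map_mx exprMn => H.
rewrite -[RHS]mulrC -/(scale d c) -H /scale; ring.
Qed.

End DeterminantRelation.

(** * The relation q(c, d)^r = q(a, d)^k(c) *)

Section CommutationRelation.
Variables (F : fieldType) (A : zmodType) (R : algType F).
Variables (tau : A -> A -> F) (bar : A -> R).
Hypothesis tw : is_twisted_group_algebra tau bar.
Variables (n : nat) (e : 'I_n -> A).
Hypothesis e_basis : forall a : A, exists! c : 'rV[int]_n, a = \sum_i e i *~ c 0 i.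
Local Notation cf := (bcoef tw).
Local Notation q := (commutation tau).
Local Notation monomial := (monomial e).
Local Notation lead_set := (lead_set tw e).
Local Notation leads := (leads tw e).
Local Notation degree_le := (degree_le tw e).

Lemma horner_bar a d (f : {poly F}) :
  horner_alg (bar a) f * bar d = bar d * horner_alg (bar a) (f \Po (q a d *: 'X)).
Proof.
elim/poly_ind: f => [|f c IH]; first by rewrite comp_poly0 rmorph0 mul0r mulr0.
rewrite comp_poly_MXaddC !rmorphD !rmorphM /= !horner_algX !horner_algC.
rewrite linearZ /= horner_algX mulrDl mulrDr mulr_algl mulr_algr; congr (_ + _).
rewrite -mulrA (bar_comm tw a d) -scalerAr.
rewrite mulr_algl -!scalerAr; congr (_ *: _); rewrite !mulrA.
by congr (_ * _).
Qed.

(** One monomial makes the exponents of finitely many elements non-negative, of bounded degree. *)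
Lemma shift_seq (s : seq A) : exists p k, forall a, a \in s ->
  exists m, (mdeg m <= k)%N /\ a + monomial p = monomial m.
Proof.
elim: s => [|a s [p [k pk]]]; first by exists mnm0, 0%N.
have [p1 [m1 apm]] := monomial_diff e_basis a.
exists (p +m p1), (k + mdeg p1 + mdeg (m1 +m p))%N => b.
rewrite inE => /predU1P[->|/pk[m [mk bm]]].
  exists (m1 +m p); rewrite !monomialD -apm leq_addl; split=> //.
  by rewrite [monomial p + _]addrC addrA.
exists (m +m p1); rewrite !monomialD addrA bm mdegD; split=> //.
by rewrite -addnA leq_add // leq_addr.
Qed.

Lemma shift_family r (E : 'I_r -> R) :
  exists p k, forall i, degree_le k (E i * bar (monomial p)).
Proof.
have /choice[s sP] i := bcoef_finite tw (E i).
have [p [k pk]] := shift_seq (flatten [seq s i | i <- enum 'I_r]).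
exists p, k => i a; rewrite -{1}[a](subrK (monomial p)) bcoef_mul_bar.
rewrite mulf_eq0 negb_or => /andP[_ /sP ai].
have [|m [mk am]] := pk (a - monomial p).
  by apply/flattenP; exists (s i) => //; apply: map_f; rewrite mem_enum.
by exists m; rewrite -am subrK.
Qed.

Lemma degree_leX k x l : degree_le k x -> degree_le k.+1 (x * bar (e l)).
Proof.
move=> xk a; rewrite -{1}[a](subrK (e l)) bcoef_mul_bar mulf_eq0 negb_or.
move=> /andP[_ /xk[m [mk am]]]; exists (m +m mnm1 l).
by rewrite monomialD monomial1 -am subrK mdegD mdeg1 addn1 ltnS.
Qed.

Lemma degree_leXn k x l t :
  degree_le k x -> degree_le (k + t) (x * bar (e l) ^+ t).
Proof.
move=> xk; elim: t => [|t IH]; first by rewrite addn0 mulr1.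
by rewrite exprSr mulrA addnS; apply: degree_leX.
Qed.

Section Factor.
Variables L U : set R.
Hypotheses (L_ideal : right_ideal L) (U_ideal : right_ideal U) (LU : L `<=` U).
Let upL := lead_set_up_closed L_ideal (e := e) (tw := tw).
Let upU := lead_set_up_closed U_ideal (e := e) (tw := tw).

Lemma right_ideal_cancel x a : L (x * bar a) -> L x.
Proof.
by move=> /(right_idealM L_ideal (ibar tau bar a)); rewrite -mulrA (bar_ibar tw) mulr1.
Qed.

(** There are at most [C] monomials in the difference, so more than [C] elements, shifted to
    non-negative exponents, are dependent modulo [L]; the shift is a unit and cancels. *)
Lemma scalar_independent_bound : no_cone 1 (lead_set U `\` lead_set L) ->
  exists C, forall r (E : 'I_r -> R), (forall i, U (E i)) ->
    independent_mod (in_alg R) L E -> (r <= C)%N.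
Proof.
move=> noD; have [C CP] := no_cone1_count upU upL noD; exists C => r E UE indE.
rewrite leqNgt; apply/negP => Cr; have [p [k Ek]] := shift_family E.
have := @quotient_dependent _ _ _ _ _ tw n e L U k _ _ L_ideal U_ideal LU _ Ek.
case=> [i||c [[i ci] Lc]].
- exact: (right_idealM U_ideal).
- by rewrite card_ord; apply: leq_ltn_trans Cr; apply: CP; apply: monomials_upto_uniq.
move: Lc; under eq_bigr => j _ do rewrite scalerAl -[X in X * _]mulr_algr.
rewrite -mulr_suml => /right_ideal_cancel /indE /(_ i) ci0.
by rewrite ci0 eqxx in ci.
Qed.

(** From [r] independent elements, [N] powers of bar (e l) give r N elements of degree at most k + N
    independent modulo [L], while the monomials number at most C (k + N + 1). *)
Lemma poly_independent_bound l : no_cone 2 (lead_set U `\` lead_set L) ->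
  exists C, forall r (E : 'I_r -> R), (forall i, U (E i)) ->
    independent_mod (horner_alg (bar (e l))) L E -> (r <= C)%N.
Proof.
move=> noD; have [C CP] := no_cone2_count upU upL noD; exists C => r E UE indE.
rewrite leqNgt; apply/negP => Cr; have [p [k Ek]] := shift_family E.
(* This [N] satisfies (C + 1) N = C (k + N + 1) + 1. *)
pose b := bar (monomial p); pose N := (C * k.+1).+1.
pose y (it : 'I_r * 'I_N) := E it.1 * b * bar (e l) ^+ it.2.
have Uy it : U (y it) by do !apply: (right_idealM U_ideal).
have yk it : degree_le (k + N) (y it).
  have := @degree_leXn k _ l it.2 (Ek it.1) => /= yit a /yit[m [mk am]].
  by exists m; split=> //; apply: leq_trans mk _; rewrite leq_add2l ltnW.
have := @quotient_dependent _ _ _ _ _ tw n e L U _ _ y L_ideal U_ideal LU Uy yk.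
case=> [|c [[[i t] cit] Lc]].
  rewrite card_prod !card_ord; apply: (@leq_ltn_trans (C * (k + N).+1)).
    apply: CP => [|m]; first exact: monomials_upto_uniq.
    by rewrite mem_monomials_upto.
  by rewrite /N; nia.
pose f i := \poly_(t < N) c (i, inord t).
have coef_f i' (t' : 'I_N) : (f i')`_t' = c (i', t').
  by rewrite coef_poly ltn_ord inord_val.
pose x := q (e l) (monomial p).
have x0 : x != 0 by apply: commutation_neq0 tw _ _.
(* Moving the shift [b] to the right of a polynomial in bar (e l) rescales the variable. *)
have fE i' : b * horner_alg (bar (e l)) (f i') =
    horner_alg (bar (e l)) (f i' \Po (x^-1 *: 'X)) * b.
  rewrite /b horner_bar -comp_polyA comp_polyZ comp_polyX scalerA.
  by rewrite mulVf // scale1r comp_polyXr.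
have : L ((\sum_i E i * horner_alg (bar (e l)) (f i \Po (x^-1 *: 'X))) * b).
  rewrite mulr_suml; under eq_bigr => j _ do rewrite -mulrA -fE mulrA.
  move: Lc; congr L; transitivity (\sum_i \sum_t c (i, t) *: y (i, t)).
    by rewrite pair_bigA /=; apply: eq_bigr => -[].
  apply: eq_bigr => j _; rewrite [f j]poly_def rmorph_sum mulr_sumr.
  apply: eq_bigr => t' _; rewrite inord_val /y /=.
  rewrite -mul_polyC rmorphM rmorphXn /= horner_algC horner_algX mulr_algl.
  by rewrite scalerAr.
move=> /right_ideal_cancel /indE /(_ i) fi0.
have : f i = 0.
  rewrite -[f i]comp_polyXr -[in LHS](scale1r 'X) -(mulVf x0) -scalerA.
  by rewrite -[x *: 'X]comp_polyX -comp_polyZ comp_polyA fi0 comp_poly0.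
by move=> fi; rewrite -coef_f fi coef0 eqxx in cit.
Qed.

Lemma leads_scaleD k x y m : k != 0 -> leads x m ->
  (forall a, cf y a != 0 -> exists p, (p < m)%O /\ a = monomial p) ->
  leads (k *: x + y) m.
Proof.
move=> k0 [xm xle] ylt.
have ym : cf y (monomial m) = 0.
  apply/eqP; apply: contraT => /ylt[p [pm /(monomial_inj e_basis) mp]].
  by rewrite mp ltxx in pm.
split=> [|a]; rewrite bcoef_linear; first by rewrite ym addr0 mulf_neq0.
have [->|/xle//] := eqVneq (cf x a) 0.
by rewrite mulr0 add0r => /ylt[p [/ltW pm ap]]; exists p.
Qed.

(** Multiplication by bar (e l) raises the degree, which the order compares first, so the top term
    of [f] dominates. *)
Lemma leads_horner u p l (f : {poly F}) : leads u p -> f != 0 ->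
  exists N, leads (u * horner_alg (bar (e l)) f) (p +m mnm_muln (mnm1 l) N).
Proof.
move=> up; elim/poly_ind: f => [|f c IH]; first by rewrite eqxx.
rewrite rmorphD rmorphM /= horner_algX horner_algC mulrDr mulr_algr mulrA.
have [->|/IH[N uN] _] := eqVneq f 0.
  rewrite mul0r add0r rmorph0 mulr0 mul0r add0r polyC_eq0 => c0; exists 0%N.
  have -> : p +m mnm_muln (mnm1 l) 0 = p.
    by apply/mnmP => i; rewrite mnmDE mulmnE muln0 addn0.
  by rewrite -[_ *: _]addr0; apply: leads_scaleD => // a; rewrite bcoef0 eqxx.
exists N.+1.
have -> : p +m mnm_muln (mnm1 l) N.+1 = p +m mnm_muln (mnm1 l) N +m mnm1 l.
  by apply/mnmP => i; rewrite !mnmDE !mulmnE mulnSr addnA.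
rewrite -[X in X + _]scale1r; apply: leads_scaleD; first exact: oner_neq0.
  by have := leadsM (mnm1 l) uN; rewrite monomial1.
move=> a; rewrite bcoefZ mulf_eq0 negb_or => /andP[_ /(up.2)[m [mp am]]].
exists m; split=> //; apply: le_lt_trans mp _.
apply: lt_mdeg_ltmc; rewrite !mdegD mdeg1; lia.
Qed.

Lemma commutation_relation : ~ U `<=` L -> no_cone 2 (lead_set U `\` lead_set L) ->
  exists a r (k : A -> int), (0 < r)%N /\
    forall c, q a c = 1 -> forall d, q c d ^+ r = q a d ^ k c.
Proof.
move=> UL no2.
have [no1|] := pselect (no_cone 1 (lead_set U `\` lead_set L)).
  (* Without 1-cones the factor is finite-dimensional over F. Scalars are not twisted, so the
     determinants cancel and q(c, d)^r = 1. *)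
  have [C CP] := scalar_independent_bound no1.
  have [u [Uu nLu]] : exists u, U u /\ ~ L u.
    apply: contrapT => noU; apply: UL => u Uu; apply: contrapT => nLu.
    by apply: noU; exists u.
  have ind1 : independent_mod (in_alg R) L (fun _ : 'I_1 => u).
    move=> f; rewrite big_ord1 => Lf i; rewrite [i]ord1; apply/eqP.
    apply: contraT => f0; exfalso; apply: nLu.
    have -> : u = u * in_alg R (f 0) * in_alg R (f 0)^-1.
      by rewrite -mulrA -rmorphM mulfV // rmorph1 mulr1.
    exact: (right_idealM L_ideal).
  have [r [E [r_gt0 UE indE spanE]]] :=
    @maximal_independent R F (fun x p => x * in_alg R p) L U C 1 (fun=> u)
      (fun x => etrans (congr1 _ (rmorph0 _)) (mulr0 x))
      (fun x p => etrans (congr1 _ (rmorphN _ p)) (mulrN x _)) (fun=> Uu) ind1 CP.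
  have [||//|D [p [Dp rel]]] := @det_relation F A R tau bar tw F (in_alg R) idfun
    (fun=> idfun) _ _ _ L U r E L_ideal U_ideal UE indE spanE.
  - by [].
  - by move=> f d; rewrite /= mulr_algl mulr_algr.
  (* As bar 0 commutes with everything, [a] = 0 and [k] = 0 express q(c, d)^r = 1 for all c and
     d. *)
  exists 0, r, (fun=> 0); split=> // c _ d; rewrite expr0z.
  have := rel c d; rewrite /= [D d * D c]mulrC [p d * p c]mulrC => relcd.
  apply: (mulIf (_ : D c * D d * (p c * p d) ^+ r != 0)).
    by rewrite !(mulf_neq0, expf_neq0) ?(Dp _).1 ?(Dp _).2.
  by rewrite mul1r -[RHS]relcd !mulrA.
(* Otherwise there is a 1-cone in some direction [l]. An element [u] of [U] leading at its apex is
   torsion-free over F[bar (e l)] modulo [L], since its nonzero multiples lead on the cone. *)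
rewrite /no_cone => /existsNP[p /existsNP[I /not_implyP[cardI /contrapT coneD]]].
have /eqP/cards1P[l Il] := cardI.
have [[u [Uu up]] _] : (lead_set U `\` lead_set L) p by apply: coneD; split.
have [C CP] := poly_independent_bound l no2.
have ind1 : independent_mod (horner_alg (bar (e l))) L (fun _ : 'I_1 => u).
  move=> f; rewrite big_ord1 => Lf i; rewrite [i]ord1; apply/eqP.
  apply: contraT => /(leads_horner l up)[N uN].
  have [] : (lead_set U `\` lead_set L) (p +m mnm_muln (mnm1 l) N).
    apply: coneD; split=> j; rewrite mnmDE ?leq_addr // Il inE mulmnE mnm1E.
    by rewrite eq_sym => /negPf ->; rewrite mul0n addn0.
  by move=> _ []; exists (u * horner_alg (bar (e l)) (f 0)).
have [r [E [r_gt0 UE indE spanE]]] :=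
  @maximal_independent R {poly F} (fun x p => x * horner_alg (bar (e l)) p) L U C 1
    (fun=> u) (fun x => etrans (congr1 _ (rmorph0 _)) (mulr0 x))
    (fun x p => etrans (congr1 _ (rmorphN _ p)) (mulrN x _)) (fun=> Uu) ind1 CP.
have sz d : size (q (e l) d *: 'X : {poly F}) = 2%N.
  by rewrite size_scale ?size_polyX ?(commutation_neq0 tw).
have [|||D [h [Dh rel]]] := @det_relation F A R tau bar tw {poly F}
  (horner_alg (bar (e l))) polyC (fun d => comp_poly (q (e l) d *: 'X)) _ _ _
  L U r E L_ideal U_ideal UE indE spanE.
- by move=> k; rewrite /= horner_algC.
- by move=> f d; rewrite horner_bar.
- move=> d f g /eqP; rewrite -subr_eq0 -rmorphB /= comp_poly_eq0 ?sz //.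
  by rewrite subr_eq0 => /eqP.
(* The exponent is deg (D c) - r deg (h c): substituting q X for X multiplies a leading coefficient
   by q to the degree. *)
exists (e l), r, (fun c => (size (D c)).-1%:Z - ((size (h c)).-1 * r)%:Z).
split=> // c qc d.
have x0 : q (e l) d != 0 by apply: commutation_neq0 tw _ _.
(* The twist by [c] is the identity, as q(e l, c) = 1; only the twist by [d] affects leading
   coefficients. *)
have := congr1 lead_coef (rel c d); rewrite /= qc scale1r !comp_polyXr -rmorphXn.
rewrite !(lead_coefM, lead_coef_exp, lead_coefC, lead_coef_comp) ?sz //.
rewrite lead_coefZ lead_coefX mulr1 => relcd.
have lD c' : lead_coef (D c') != 0 by rewrite lead_coef_eq0 (Dh _).1.
have lh c' : lead_coef (h c') != 0 by rewrite lead_coef_eq0 (Dh _).2.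
rewrite expfzDr // -exprnN -!exprnP exprM.
move: (q (e l) d) (q c d) x0 relcd => x y x0 relcd.
apply: (mulIf (_ : lead_coef (D c) * lead_coef (D d) *
   (lead_coef (h c) * lead_coef (h d)) ^+ r *
   (x ^+ (size (h c)).-1) ^+ r != 0)).
  by repeat first [exact: x0 | exact: lD | exact: lh | apply: expf_neq0 |
    apply: mulf_neq0].
rewrite !exprMn in relcd *.
transitivity (y ^+ r * lead_coef (D c) * lead_coef (D d) *
  (lead_coef (h c) ^+ r * (x ^+ (size (h c)).-1) ^+ r * lead_coef (h d) ^+ r)).
  ring.
by rewrite relcd; field; rewrite !expf_neq0.
Qed.

End Factor.
End CommutationRelation.

(** * Ranks *)

Lemma commutation_comm (F : fieldType) (A : zmodType) (R : algType F)
    (tau : A -> A -> F) (bar : A -> R) a b : is_twisted_group_algebra tau bar ->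
  commutation tau b a = (commutation tau a b)^-1.
Proof.
move=> tw; apply: (mulfI (commutation_neq0 tw a b)).
by rewrite (commutationC tw) mulfV ?(commutation_neq0 tw).
Qed.

(** A rational solution is multiplied by the product of its denominators. *)
Lemma int_row_kernel (r s : nat) (f : 'I_r -> 'I_s -> int) : (s < r)%N ->
  exists c : 'I_r -> int, (exists i, c i != 0) /\ forall j, \sum_i c i * f i j = 0.
Proof.
move=> sr; have [|c [[i0 ci0] cf]] :=
  @row_kernel rat 'I_r s (fun i j => (f i j)%:~R); first by rewrite card_ord.
pose d i := \prod_(k | k != i) denq (c k).
have cE i : (numq (c i) * d i)%:~R = c i * (\prod_k denq (c k))%:~R :> rat.
  rewrite (bigD1 i) //= !rmorphM /= -/(d i) mulrA; congr (_ * _).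
  by rewrite -{2}[c i]divq_num_den divfK // intr_eq0 denq_neq0.
exists (fun i => numq (c i) * d i); split.
  exists i0; rewrite mulf_neq0 ?numq_eq0 //.
  by apply/prodf_neq0 => k _; apply: denq_neq0.
move=> j; apply/eqP; rewrite -(intr_eq0 rat) rmorph_sum /=.
under eq_bigr => i _ do rewrite rmorphM /= cE mulrAC.
by rewrite -mulr_suml cf mul0r.
Qed.

(** Take [c] maximal independent modulo [B], and [g] maximal independent in [B]. Every element of A
    has a nonzero multiple in the span of both, so [n] is at most the sum of their sizes. *)
Lemma rank_complement (A : zmodType) (B : set A) n w :
  is_subgroup B -> is_rank [set: A] n ->
  (forall s, has_Zindependent B s -> (s <= w)%N) ->
  exists s (c : 'I_s -> A), (n <= s + w)%N /\
    forall k : 'I_s -> int, B (\sum_i c i *~ k i) -> forall i, k i = 0.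
Proof.
move=> [B0 _] [[f [_ f_indep]] rank_max] B_max.
have act0 (x : A) : x *~ 0 = 0 by rewrite mulr0z.
have actN (x : A) k : x *~ (- k) = - (x *~ k) by rewrite mulrNz.
have ind0 (L : set A) (E : 'I_0 -> A) : independent_over (@intmul A) L E.
  by move=> ? _ [].
have [s [c [_ _ c_indep c_span]]] := @maximal_independent A int (@intmul A) B setT n 0
  (fun=> 0) act0 actN (fun=> I) (ind0 _ _) (fun r E _ indE =>
  rank_max r (ex_intro _ E (conj (fun=> I) (fun k k0 => indE k
    (eq_ind_r B B0 k0))))).
have [w' [g [_ Bg g_indep g_span]]] :=
  @maximal_independent A int (@intmul A) [set 0] B w 0
  (fun=> 0) act0 actN (fun=> B0) (ind0 _ _) (fun r E BE indE =>
  B_max r (ex_intro _ E (conj BE indE))).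
have w'w : (w' <= w)%N by apply: B_max; exists g.
exists s, c; split=> //; apply: leq_trans (leq_add (leqnn s) w'w).
rewrite leqNgt; apply/negP => lt_n.
pose cg (i : 'I_(s + w')) :=
  match fintype.split i with inl i => c i | inr i => g i end.
have /choice[N NP] j : exists N : int * ('I_(s + w') -> int), N.1 != 0 /\
    f j *~ N.1 = \sum_(i < s + w') cg i *~ N.2 i.
  have [p [k [p0 Bpk]]] := c_span (f j) I.
  have [p' [k' [p'0 /= pk']]] := g_span _ Bpk.
  exists (p * p', fun i =>
    match fintype.split i with inl i => k i * p' | inr i => k' i end).
  rewrite /= mulf_neq0 //; split=> //; rewrite big_split_ord /cg /=.
  under eq_bigr => i _ do rewrite -[lshift _ _]/(unsplit (inl i)) unsplitK mulrzA.
  under [X in _ + X]eq_bigr => i _ do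
    rewrite -[rshift _ _]/(unsplit (inr i)) unsplitK.
  move/eqP: pk'; rewrite subr_eq0 mulrzBl => /eqP <-.
  by rewrite -mulrz_suml addrC subrK mulrzA.
have [y [[j0 yj0] yN]] := int_row_kernel (fun j i => (N j).2 i) lt_n.
have : \sum_j f j *~ ((N j).1 * y j) = 0.
  under eq_bigr => j _ do rewrite mulrzA (NP j).2 mulrz_suml.
  rewrite exchange_big big1 //= => i _.
  under eq_bigr => j _ do rewrite -mulrzA mulrC.
  by rewrite -mulrz_sumr yN mulr0z.
move=> /f_indep/(_ j0)/eqP; rewrite mulf_eq0 (negPf yj0) orbF.
by rewrite (negPf (NP j0).1).
Qed.

Section Centralizer.
Variables (F : fieldType) (A : zmodType) (R : algType F).
Variables (tau : A -> A -> F) (bar : A -> R).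
Hypothesis tw : is_twisted_group_algebra tau bar.
Local Notation q := (commutation tau).
Variables (Z : set A) (rkZ : nat).
Hypotheses (centerZ : @ring_center R = twisted_sub bar Z) (rankZ : is_rank Z rkZ).

(* If k (c i0) <> 0, the elements r (k (c i0) c_i - k (c_i) c_i0) are central. *)
Lemma rank_centralizer a r (k : A -> int) : (0 < r)%N ->
  (forall c, q a c = 1 -> forall d, q c d ^+ r = q a d ^ k c) ->
  forall s, has_Zindependent [set c | q a c = 1] s -> (s <= rkZ.+1)%N.
Proof.
move=> r_gt0 rel s [c [qc c_indep]].
have central x : (forall d, q x d = 1) -> Z x by apply: (center_bar tw centerZ).
(* If [k] vanishes on all c_i, the multiples r c_i are themselves central. *)
have [k0|] := pselect (forall i, k (c i) = 0).
  apply/leqW/(rankZ.2 s); exists (fun i => c i *+ r); split=> [i|g].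
    apply: central => d; rewrite (commutationMn tw) (rel _ (qc i)) k0.
    by rewrite expr0z.
  under eq_bigr => i _ do rewrite pmulrn -mulrzA.
  move=> /c_indep cg i; have /eqP := cg i; rewrite mulf_eq0.
  by rewrite eqz_nat eqn0Ngt r_gt0 => /eqP.
move=> /existsNP[i0 ki0]; case: s => [|s] // in c qc c_indep i0 ki0 *.
rewrite ltnS; apply: rankZ.2.
exists (fun j => (c (lift i0 j) *~ k (c i0) - c i0 *~ k (c (lift i0 j))) *+ r).
split=> [j|g].
  apply: central => d; rewrite (commutationMn tw) (commutationDl tw).
  rewrite (commutationNl tw) !(commutationMz tw) exprMn exprVn.
  have swap (z : F) m : (z ^ m) ^+ r = (z ^+ r) ^ m.
    by rewrite !exprnP !exprz_exp mulrC.
  rewrite !swap !(rel _ (qc _)) !exprz_exp [k (c i0) * _]mulrC mulfV //.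
  exact/expfz_neq0/(commutation_neq0 tw).
move=> g0 j.
pose h i := if unlift i0 i is Some j then k (c i0) * r%:Z * g j
  else - \sum_j k (c (lift i0 j)) * r%:Z * g j.
have /c_indep/(_ (lift i0 j)) : \sum_i c i *~ h i = 0.
  rewrite (bigD1_ord i0) //= {1}/h unlift_none mulrNz mulrz_sumr -sumrN.
  rewrite -big_split -[RHS]g0; apply: eq_bigr => l _.
  rewrite /h liftK pmulrn -!mulrzA mulrzBl -!mulrzA addrC.
  by rewrite !mulrA.
rewrite /h liftK => /eqP; rewrite !mulf_eq0 => /orP[/orP[/eqP//|]|/eqP//].
by rewrite eqz_nat eqn0Ngt r_gt0.
Qed.

End Centralizer.

(** * Simple modules *)

Section QuotientModule.
Variables (S : nzRingType) (V : lmodType S) (N : zmodClosed V).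
Hypothesis N_scale : forall a v, v \in N -> a *: v \in N.
Local Open Scope quotient_scope.

Local Notation Q := (Quotient.quot N).
Local Notation pi := (\pi_Q).

Definition quotient_scale (a : S) (x : Q) : Q := pi (a *: repr x).

Lemma pi_scale a v : quotient_scale a (pi v) = pi (a *: v).
Proof.
apply/eqP; rewrite -Quotient.idealrBE -scalerBr N_scale //.
by rewrite Quotient.idealrBE reprK.
Qed.

Lemma pi_D u v : pi u + pi v = pi (u + v).
Proof. exact/esym/(@pi_addr _ _ _ _ _ Q u v). Qed.

Lemma pi_surj x : exists v, x = pi v.
Proof. by exists (repr x); rewrite reprK. Qed.

Lemma quotient_scaleA a b x :
  quotient_scale a (quotient_scale b x) = quotient_scale (a * b) x.
Proof. by have [v ->] := pi_surj x; rewrite !pi_scale scalerA. Qed.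

Lemma quotient_scale1 : left_id 1 quotient_scale.
Proof. by move=> x; have [v ->] := pi_surj x; rewrite pi_scale scale1r. Qed.

Lemma quotient_scaleDr : right_distributive quotient_scale +%R.
Proof.
move=> a x y; have [u ->] := pi_surj x; have [v ->] := pi_surj y.
by rewrite pi_D !pi_scale pi_D scalerDr.
Qed.

Lemma quotient_scaleDl x : {morph quotient_scale^~ x : a b / a + b}.
Proof. by move=> a b; have [v ->] := pi_surj x; rewrite !pi_scale pi_D scalerDl. Qed.

Lemma quotient_lmodule : exists (M : lmodType S) (p : V -> M),
  [/\ forall a u v, p (a *: u + v) = a *: p u + p v,
      forall x, exists v, x = p v & forall v, p v = 0 <-> v \in N].
Proof.
pose mix := GRing.Zmodule_isLmodule.Build S Q quotient_scaleA quotient_scale1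
  quotient_scaleDr quotient_scaleDl.
pose M : lmodType S := HB.pack Q mix.
exists M, (pi : V -> M); split.
- by move=> a u v; rewrite -[RHS]/(quotient_scale a (pi u) + pi v) pi_scale pi_D.
- exact: pi_surj.
move=> v; rewrite -[v in v \in N]subr0 Quotient.idealrBE.
have -> : (0 : M) = pi 0 by rewrite -[LHS]/(0 : Q) piE.
by split=> [->|/eqP].
Qed.

End QuotientModule.

Section MaximalRightIdeal.
Variables (R : nzRingType) (I : set R).

Lemma maximal_right_ideal : right_ideal I -> ~ I 1 ->
  exists J : set R, [/\ right_ideal J, ~ J 1, I `<=` J &
    forall K, right_ideal K -> ~ K 1 -> J `<=` K -> K `<=` J].
Proof.
move=> idI nI1.
pose P (J : set R) := [/\ right_ideal J, ~ J 1 & I `<=` J] \/ J = set0.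
have [G GP Gtot|J [[[idJ nJ1 IJ]|J0] maxJ]] := @Zorn_bigcup _ P.
- have [[J [GJ J1]]|none] := pselect (exists J, G J /\ J 0); last first.
    right; rewrite -subset0 => x [J GJ Jx]; apply: none; exists J; split=> //.
    by case: (GP J GJ) => [[[]]//|J0]; rewrite J0 in Jx.
  have GI K x : G K -> K x -> [/\ right_ideal K, ~ K 1 & I `<=` K].
    by move=> /GP[//|->].
  left; split=> [||x Ix].
  + split=> [|x u v [K1 GK1 K1u] [K2 GK2 K2v]]; first by exists J.
    have [K12|K21] := Gtot _ _ GK1 GK2.
      by exists K2 => //; have [[_ KD] _ _] := GI _ _ GK2 K2v;
        apply: KD => //; exact: K12.
    by exists K1 => //; have [[_ KD] _ _] := GI _ _ GK1 K1u;
      apply: KD => //; exact: K21.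
  + by move=> [K GK K1]; case: (GI _ _ GK K1).
  + by exists J => //; have [_ _] := GI _ _ GJ J1; apply.
- exists J; split=> // K idK nK1 JK; apply: contrapT => nKJ.
  apply: (maxJ K); first by split.
  by left; split=> //; apply: subset_trans JK.
exfalso; apply: (maxJ I); last by left; split.
by rewrite J0; split=> [? []|/(_ 0 idI.1)].
Qed.

End MaximalRightIdeal.

(** Here [M] is R / J for a maximal right ideal [J] above [I], and [u] is the class of 1. *)
Lemma simple_quotient (R : nzRingType) (I : set R) : right_ideal I -> ~ I 1 ->
  exists (M : lmodType R^c) (u : M) (J : set R), [/\ is_simple M, I `<=` J,
    right_ideal J, ~ J 1 & forall x, ract u x = 0 <-> J x].
Proof.
move=> idI nI1; have [J [idJ nJ1 IJ maxJ]] := maximal_right_ideal idI nI1.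
have [J0 JD] := idJ.
pose pJ : {pred (R^c)^o} := fun v => `[< J v >].
have pJE v : (v \in pJ) = `[< J v >] by [].
have zJ : zmod_closed pJ.
  split=> [|u v]; rewrite !pJE; first exact/asboolP.
  move=> /asboolP Ju /asboolP Jv; apply/asboolP.
  have -> : u - v = (v : R) * -1 + (u : R) by rewrite mulrN1 addrC.
  exact: JD.
pose N : zmodClosed (R^c)^o := HB.pack pJ (GRing.isZmodClosed.Build _ pJ zJ).
have Nscale (a : R^c) v : v \in N -> a *: v \in N.
  move=> /asboolP Jv; apply/asboolP.
  by rewrite -[a *: v]addr0; apply: JD.
have [M [pi [pi_lin pi_surj pi0]]] := quotient_lmodule Nscale.
pose p (x : R) : M := pi x.
have p_lin (x u v : R) : p (u * x + v) = ract (p u) x + p v by exact: (pi_lin x u v).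
have p0 v : p v = 0 <-> J v by apply: (iff_trans (pi0 v)); split=> /asboolP.
have p00 : p 0 = 0 by apply/p0.
have pE x : p x = ract (p 1) x.
  by rewrite -[x in LHS]mul1r -[1 * x]addr0 p_lin p00 addr0.
exists M, (p 1), J; split=> //; last by move=> x; rewrite -pE p0.
split; first by exists (p 1); apply/eqP => /p0.
move=> K [K0 KD].
(* The preimage of a submodule is a right ideal containing [J]; by maximality it contains 1 or
   equals [J]. *)
have idK : right_ideal [set x | K (p x)].
  split=> [|x u v Ku Kv] /=; first by rewrite p00.
  by rewrite p_lin; apply: KD.
have JK : J `<=` [set x | K (p x)] by move=> x Jx /=; rewrite (p0 x).2.
have [K1|nK1] := pselect (K (p 1)).
  right; apply/seteqP; split=> // x _; have [v ->] := pi_surj x.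
  by rewrite -[pi v]/(p v) pE -[ract _ _]addr0; apply: KD.
left; apply/seteqP; split=> x; last by move=> ->.
have [v ->] := pi_surj x => Kv; apply/(p0 v).
exact: (maxJ _ idK nK1 JK).
Qed.

(** * Eigenvectors modulo a right ideal *)

Section CommonEigenvector.
Variables (F : fieldType) (A : zmodType) (R : algType F).
Variables (tau : A -> A -> F) (bar : A -> R).
Hypothesis tw : is_twisted_group_algebra tau bar.
Local Notation q := (commutation tau).
Local Notation cf := (bcoef tw).

Lemma bcoef_not_injective x (g : nat -> A) :
  injective g -> (forall k, cf x (g k) != 0) -> False.
Proof.
move=> g_inj xg; have [s xs] := bcoef_finite tw x.
have sub : {subset [seq g k | k <- iota 0 (size s).+1] <= s}.
  by move=> _ /mapP[k _ ->]; apply: xs.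
have := uniq_leq_size _ sub; rewrite map_inj_uniq // iota_uniq size_map size_iota.
by rewrite ltnn => /(_ isT).
Qed.

(* For a <> 0, the relation (bar a - l) x = 1 propagates the support of x along
   a half-line in the direction of a or of - a. *)
Lemma bar_sub_not_unit a x : (forall k, a *+ k.+1 = 0 -> a = 0) ->
  (bar a - (tau 0 0)%:A) * x <> 1.
Proof.
move=> a_free ax1; pose l := tau 0 0.
have l0 : l != 0 by apply: tau_neq0 tw _ _.
have [a0|a0] := eqVneq a 0.
  by move: ax1; rewrite a0 (bar0 tw) subrr mul0r => /eqP; rewrite eq_sym oner_eq0.
have free k m : a *+ k = a *+ m -> k = m.
  wlog km : k m / (k <= m)%N => [wl|].
    by case: (leqP k m) => [/wl//|/ltnW/wl mk /esym/mk].
  rewrite -{1}(subnK km) mulrnDr -{1}[a *+ k]add0r => /addIr/esym.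
  case mk: (m - k)%N => [|d] amk; first by apply/eqP; rewrite eqn_leq km -subn_eq0 mk.
  by rewrite (a_free d amk) eqxx in a0.
have rel b : tau a b * cf x b - l * cf x (a + b) = cf 1 (a + b).
  by rewrite -ax1 mulrBl mulr_algl bcoefB bcoefZ bcoef_bar_mul.
have cf1 b : (cf 1 b == 0) = (b != 0).
  have -> : 1 = l^-1 *: bar 0 by rewrite (bar0 tw) scalerA mulVf ?scale1r.
  rewrite bcoefZ bcoef_bar mulf_eq0 invr_eq0 (negPf l0) /=.
  by case: (b == 0); rewrite ?oner_eq0 ?eqxx.
have prop b : a + b != 0 -> (cf x b == 0) = (cf x (a + b) == 0).
  rewrite -cf1 -rel subr_eq0 => /eqP tauE.
  have := mulf_eq0 (tau a b) (cf x b); rewrite (negPf (tau_neq0 tw a b)) /= => <-.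
  by rewrite tauE mulf_eq0 (negPf l0).
have nz k : a *+ k.+1 != 0 by apply: contra a0 => /eqP/a_free ->.
have [x0|x0] := eqVneq (cf x 0) 0.
  apply: (@bcoef_not_injective x (fun k => - (a *+ k.+1))).
    by move=> k m /oppr_inj /free [].
  elim=> [|k IH].
    have := rel (- a); rewrite subrr x0 mulr0 subr0 mulr1n => xa.
    apply/eqP => xa0; move: xa; rewrite xa0 mulr0 => /esym/eqP.
    by rewrite cf1 eqxx.
  have aE : a - a *+ k.+2 = - (a *+ k.+1) by rewrite mulrS opprD addrA subrr add0r.
  by rewrite prop aE // oppr_eq0.
apply: (@bcoef_not_injective x (fun k => a *+ k)); first exact: free.
by elim=> [|k IH] //; rewrite mulrS -prop // -mulrS.
Qed.

Section Eigenvector.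
Variables (J : set R) (a : A) (l : F).
Hypotheses (J_ideal : right_ideal J) (J_proper : ~ J 1).
Hypotheses (l_neq0 : l != 0) (J_a : J (bar a - l%:A)).

(** Modulo [J], bar c is an eigenvector of bar a with eigenvalue q(c, a) l, so polynomials in bar a
    act on it by evaluation. *)
Lemma eigenvector_horner c (f : {poly F}) :
  J (bar c * horner_alg (bar a) f - f.[q c a * l] *: bar c).
Proof.
elim/poly_ind: f => [|f k IH].
  by rewrite rmorph0 mulr0 horner0 scale0r subrr; apply: right_ideal0.
rewrite rmorphD rmorphM /= horner_algX horner_algC hornerMXaddC mulrDr mulr_algr.
rewrite scalerDl opprD addrACA subrr addr0 mulrA.
have -> : bar c * horner_alg (bar a) f * bar a -
    (f.[q c a * l] * (q c a * l)) *: bar c =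
    (bar c * horner_alg (bar a) f - f.[q c a * l] *: bar c) * bar a +
    (f.[q c a * l] * q c a) *: ((bar a - l%:A) * bar c).
  rewrite !mulrBl mulr_algl scalerBr -scalerAl (bar_comm tw c a) !scalerA.
  by rewrite addrA subrK mulrA.
apply: (right_idealD J_ideal); first exact: (right_idealM J_ideal).
by apply: (right_idealZ J_ideal); apply: (right_idealM J_ideal).
Qed.

(** A polynomial in bar a vanishing at all the other eigenvalues isolates one term; if its
    coefficient were nonzero, the proper ideal [J] would contain a unit. *)
Lemma eigenvectors_independent (I : finType) (c : I -> A) (k : I -> F) :
  (forall i j, q (c i) a = q (c j) a -> i = j) ->
  J (\sum_i k i *: bar (c i)) -> forall i, k i = 0.
Proof.
move=> q_inj Jk i0; pose f : {poly F} := \prod_(j | j != i0) ('X - (q (c j) a * l)%:P).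
have f0 j : j != i0 -> f.[q (c j) a * l] = 0.
  by move=> ji; rewrite horner_prod (bigD1 j) //= hornerXsubC subrr mul0r.
have fi0 : f.[q (c i0) a * l] != 0.
  rewrite horner_prod; apply/prodf_neq0 => j ji; rewrite hornerXsubC subr_eq0.
  by apply: contra ji => /eqP/(mulIf l_neq0)/q_inj ->.
have : J (\sum_i k i *: (f.[q (c i) a * l] *: bar (c i))).
  apply: (right_idealBr J_ideal) (right_idealM J_ideal (horner_alg (bar a) f) Jk).
  rewrite -opprB -scaleN1r; apply: (right_idealZ J_ideal).
  rewrite mulr_suml -sumrB; apply: right_ideal_sum => // i.
  rewrite -scalerAl -scalerBr; apply: (right_idealZ J_ideal).
  exact: eigenvector_horner.
rewrite (bigD1 i0) //= big1 => [|j ji]; last by rewrite f0 // scale0r scaler0.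
rewrite addr0 scalerA => Jki; apply/eqP; apply: contraT => ki0.
have kf0 : k i0 * f.[q (c i0) a * l] != 0 by rewrite mulf_neq0.
exfalso; apply: J_proper.
rewrite -(bar_ibar tw (c i0)) -[bar _]scale1r -(mulVf kf0) -scalerA.
by apply: (right_idealM J_ideal); apply: (right_idealZ J_ideal).
Qed.

End Eigenvector.
End CommonEigenvector.

(** * Lower bounds for growth *)

Lemma limn_esup_ge (K : realType) (u : nat -> \bar K) (l : \bar K) :
  (forall k, (2 <= k)%N -> (l <= u k)%E) -> (l <= limn_esup u)%E.
Proof.
move=> lu; rewrite limn_esup_lim; apply: lime_ge; first exact: is_cvg_esups.
apply: nearW => k; apply: le_trans (lu k.+2 isT) _.
apply: ereal_sup_ubound; exists k.+2 => //=; lia.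
Qed.

Lemma ract_ract (R : nzRingType) (M : lmodType R^c) (u : M) (x y : R) :
  ract (ract u x) y = ract u (x * y).
Proof. by rewrite /ract scalerA. Qed.


(** Independence makes the [v t] distinct, so their first positions in [s] form an index set of size
    #|T| that enters the maximum. *)
Lemma dim_span_ge (F : fieldType) (R : algType F) (M : lmodType R^c)
    (s : seq M) (T : finType) (v : T -> M) :
  (forall t, v t \in s) ->
  (forall c : T -> F, \sum_t ract (v t) (c t)%:A = 0 -> forall t, c t = 0) ->
  (#|T| <= Defs.dim_span s)%N.
Proof.
move=> vs v_free.
have idx_lt t : (index (v t) s < size s)%N by rewrite index_mem.
pose idx t : 'I_(size s) := Ordinal (idx_lt t).
have idxE t : s`_(idx t) = v t by rewrite nth_index.
have idx_inj : injective idx.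
  move=> t t' tt'; apply/eqP; apply: contraT => neq.
  have delta w : \sum_u ract (v u) ((u == w)%:R%:A : R) = v w.
    rewrite (bigD1 w) //= eqxx scale1r /ract scale1r big1 ?addr0 // => u /negPf ->.
    by rewrite scale0r scale0r.
  have := v_free (fun u => (u == t)%:R - (u == t')%:R) _ t.
  rewrite eqxx (negPf neq) subr0 => /(_ _)/eqP; rewrite oner_eq0; apply.
  under eq_bigr => u _ do rewrite /ract (scalerBl _ _ (1 : R)) scalerBl.
  by rewrite sumrB !delta -!idxE tt' subrr.
rewrite -cardsT -(card_imset _ idx_inj).
apply: (leq_bigmax_cond (F := fun J : {set 'I_(size s)} => #|J|)).
apply/asboolP => c; rewrite (big_imset _ (in2W idx_inj)) /= => c0 _ /imsetP[t _ ->].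
apply: (v_free (c \o idx)); rewrite -[RHS]c0.
by apply: eq_big => [u|u _]; rewrite ?inE //= idxE.
Qed.

Section GrowthLowerBound.
Variables (F : fieldType) (A : zmodType) (R : algType F).
Variables (tau : A -> A -> F) (bar : A -> R).
Hypothesis tw : is_twisted_group_algebra tau bar.
Variables (M : lmodType R^c) (u : M) (s : nat) (c : 'I_s -> A).

(** One generator for each 0-1 vector, so that stage [k] of the growth reaches the whole box
    [0, k]^s. *)
Let vs : seq R := [seq bar (\sum_(i in B) c i) | B : {set 'I_s}].

Lemma growth_seq_box k (f : 'I_s -> nat) : (forall i, (f i <= k)%N) ->
  exists t, t != 0 /\
    ract u (t *: bar (\sum_i c i *+ f i)) \in growth_seq vs [:: u] k.
Proof.
elim: k f => [|k IH] f fk.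
  exists (tau 0 0)^-1; rewrite invr_eq0 (tau_neq0 tw); split=> //.
  rewrite big1 => [|i _]; last by move: (fk i); rewrite leqn0 => /eqP ->.
  rewrite (bar0 tw) scalerA mulVf ?(tau_neq0 tw) // scale1r.
  by rewrite /ract scale1r inE.
have [i|t [t0 tk]] := IH (fun i => (f i).-1); first by have := fk i; lia.
(* The generator of [B] restores exactly the exponents that were lowered. *)
pose B := [set i | (0 < f i)%N]%SET.
pose b := \sum_(i in B) c i.
exists (t * tau (\sum_i c i *+ (f i).-1) b); split.
  by rewrite mulf_neq0 ?(tau_neq0 tw).
have -> : \sum_i c i *+ f i = \sum_i c i *+ (f i).-1 + b.
  rewrite /b [X in _ + X]big_mkcond -big_split; apply: eq_bigr => i _ /=.
  by rewrite inE; case: (f i) => [|m] /=; rewrite ?addr0 // mulrSr.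
rewrite -scalerA -(bar_mul tw) scalerAl -ract_ract /= mem_cat; apply/orP; right.
by apply: allpairs_f => //; apply: map_f; rewrite mem_enum.
Qed.

Variables (J : set R) (a : A) (l : F).
Hypotheses (J_ideal : right_ideal J) (J_proper : ~ J 1).
Hypotheses (l_neq0 : l != 0) (J_a : J (bar a - l%:A)).
Hypothesis u_ann : forall x, ract u x = 0 <-> J x.
Hypothesis c_free : forall k : 'I_s -> int,
  commutation tau a (\sum_i c i *~ k i) = 1 -> forall i, k i = 0.

(** By [c_free], the points of the box give distinct eigenvalues, hence independent vectors. *)
Lemma growth_seq_dim k : (k.+1 ^ s <= Defs.dim_span (growth_seq vs [:: u] k))%N.
Proof.
pose T := {ffun 'I_s -> 'I_k.+1}.
have -> : (k.+1 ^ s)%N = #|{: T}| by rewrite card_ffun !card_ord.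
pose elt (f : T) := \sum_i c i *+ f i.
have /choice[t tP] (f : T) : exists t, t != 0 /\
    ract u (t *: bar (elt f)) \in growth_seq vs [:: u] k.
  by apply: growth_seq_box => i; rewrite -ltnS.
apply: (dim_span_ge (v := fun f => ract u (t f *: bar (elt f)))) => [f|d].
  exact: (tP f).2.
under eq_bigr => f _ do
  rewrite ract_ract -scalerAr mulr1 scalerA.
have -> : \sum_f ract u ((d f * t f) *: bar (elt f)) =
    ract u (\sum_f (d f * t f) *: bar (elt f)) by rewrite /ract scaler_suml.
move=> /u_ann Jsum f.
have /eqP : d f * t f = 0.
  apply: (eigenvectors_independent tw J_ideal J_proper l_neq0 J_a (c := elt)) Jsum _.
  move=> g h gh; apply/ffunP => i; apply: val_inj.
  have := c_free (k := fun i => (g i)%:Z - (h i)%:Z) _ i.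
  move=> /(_ _)/eqP; rewrite subr_eq0 eqz_nat => H; apply/eqP; apply: H.
  have -> : \sum_i c i *~ ((g i)%:Z - (h i)%:Z) = elt g - elt h.
    by rewrite -sumrB; apply: eq_bigr => j _; rewrite mulrzBr -!pmulrn.
  rewrite (commutation_comm _ _ tw) (commutationDl tw) (commutationNl tw) gh.
  by rewrite mulfV ?invr1 ?(commutation_neq0 tw).
by rewrite mulf_eq0 (negPf (tP f).1) orbF => /eqP.
Qed.

Lemma GKdim_ge (K : realType) : (s%:R%:E <= GKdim M K)%E.
Proof.
apply: ereal_sup_ge; eexists; first by exists vs, [:: u]; reflexivity.
(* For k >= 2 the logarithm of [k] is positive, and a dimension of at least k^s makes the quotient
   at least [s]. *)
apply: limn_esup_ge => k k2; rewrite lee_fin.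
have lnk : 0 < ln k%:R :> K by rewrite ln_gt0 // ltr1n.
rewrite ler_pdivlMr // mulr_natl -lnXn ?ltr0n ?(ltnW k2) //.
have le_dim := growth_seq_dim k.
have ks : (k ^ s <= Defs.dim_span (growth_seq vs [:: u] k))%N.
  by apply: leq_trans le_dim; case: (s) => // s'; rewrite leq_exp2r.
have k0 : (0 < k ^ s)%N by rewrite expn_gt0 (ltnW k2).
by rewrite -natrX ler_ln ?posrE ?ltr0n ?ler_nat // (leq_trans k0).
Qed.

End GrowthLowerBound.

(** * Bases of free abelian groups and the choice of the module *)

Lemma basis_Zindependent (A : zmodType) n (e : 'I_n -> A) :
  (forall a : A, exists! c : 'rV[int]_n, a = \sum_i e i *~ c 0 i) -> Zindependent e.
Proof.
move=> e_basis c c0; have [z [_ z_uniq]] := e_basis 0.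
have zE (k : 'I_n -> int) : \sum_i e i *~ k i = 0 -> z = \row_i k i.
  by move=> k0; apply: z_uniq; rewrite -[LHS]k0; apply: eq_bigr => i _; rewrite mxE.
have z0 : z = \row_i 0 by apply: zE; rewrite big1 // => i _; rewrite mulr0z.
by move=> i; have /rowP/(_ i) := zE c c0; rewrite z0 !mxE.
Qed.

Lemma basis_torsion_free (A : zmodType) n (e : 'I_n -> A) :
  (forall a : A, exists! c : 'rV[int]_n, a = \sum_i e i *~ c 0 i) ->
  forall (a : A) k, a *+ k.+1 = 0 -> a = 0.
Proof.
move=> e_basis a k ak; have [c [aE _]] := e_basis a.
have c0 : forall i, c 0 i * k.+1%:Z = 0.
  apply: (basis_Zindependent e_basis); rewrite -[RHS]ak [in RHS]aE -sumrMnl.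
  by apply: eq_bigr => i _; rewrite pmulrn mulrzA.
rewrite aE big1 // => i _; have /eqP := c0 i; rewrite mulf_eq0 orbF => /eqP ->.
by rewrite mulr0z.
Qed.

Theorem theorem5p3 (K : realType) (F : fieldType) (A : zmodType)
    (R : algType F) (tau : A -> A -> F) (bar : A -> R)
    (Z : set A) (rkA rkZ d : nat) :
  fg_free_abelian A ->
  is_twisted_group_algebra tau bar ->
  is_rank [set: A] rkA ->
  Krull_dim R d ->
  d%:Z = rkA%:Z - 1 ->
  is_subgroup Z ->
  @ring_center R = twisted_sub bar Z ->
  is_rank Z rkZ ->
  exists M : lmodType R^c,
    is_simple M /\
    ((rkA%:R - rkZ%:R - 1 : K)%:E <= GKdim M K)%E.
Proof.
move=> [n [e e_basis]] tw rankA [_ ndev] dE _ centerZ rankZ.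
(* The basis is independent, so [n] is at most rkA = d + 1. *)
have n_le : (n <= d.+1)%N.
  have : (n <= rkA)%N.
    by apply: rankA.2; exists e; split=> //; apply: basis_Zindependent.
  by lia.
have [L [U [idL idU LU UL noD]]] := Krull_factor tw e n_le ndev.
have [a [r [k [r_gt0 rel]]]] := commutation_relation e_basis idL idU LU UL noD.
pose C := [set c | commutation tau a c = 1].
have subC : is_subgroup C.
  have CE x : C x <-> commutation tau x a = 1.
    rewrite /C /= (commutation_comm x a tw).
    by split=> [/(congr1 GRing.inv)|->]; rewrite ?invrK invr1.
  split=> [|x y /CE Cx /CE Cy]; apply/CE; first exact: commutation0l tw _.
  exact: (commutation_subl_eq1 tw).
(* The centralizer of [a] has rank at most rkZ + 1; this leaves s >= rkA - rkZ - 1 elements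
   independent modulo it. *)
have [s [c [s_ge c_free]]] :=
  rank_complement subC rankA (rank_centralizer tw centerZ rankZ r_gt0 rel).
(* Since bar 0 = tau 0 0, this [l] keeps bar a - l from being right invertible even when a = 0. *)
pose l := tau 0 0; have l0 : l != 0 by apply: tau_neq0 tw _ _.
pose I := [set x | exists y, x = (bar a - l%:A) * y].
have idI : right_ideal I.
  split=> [|x _ _ [u ->] [v ->]]; first by exists 0; rewrite mulr0.
  by exists (u * x + v); rewrite mulrDr mulrA.
have nI1 : ~ I 1.
  move=> [y /esym]; apply: (bar_sub_not_unit tw).
  exact: basis_torsion_free e_basis a.
have [M [u [J [simpleM IJ idJ nJ1 u_ann]]]] := simple_quotient idI nI1.
exists M; split=> //.
have Ja : J (bar a - l%:A) by apply: IJ; exists 1; rewrite mulr1.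
apply: le_trans (GKdim_ge tw idJ nJ1 l0 Ja u_ann c_free K).
rewrite lee_fin -addrA -opprD natr1 lerBlDr -natrD ler_nat; lia.
Qed.
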